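(* For each integer $n\geqslant 3$, there exists a finite locally 2-arc-transitive graph of straight-nondiagonal type with valencies $\{n,9\}$. That is, there exist a finite graph $\Gamma$ and a group $G\leqslant\mathrm{Aut}(\Gamma)$ with exactly two vertex orbits such that $\Gamma$ is locally $(G,2)$-arc-transitive, the vertices in one orbit have valency $n$ and those in the other have valency $9$, $G$ is quasiprimitive of type PA on both orbits, and $G$ is of straight diagonal type on one orbit and of nondiagonal type on the other.
   Context: An $s$-arc in a graph $\Gamma$ is an $(s+1)$-tuple $(\alpha_0,\dots,\alpha_s)$ of vertices with $\alpha_i$ adjacent to $\alpha_{i+1}$ and $\alpha_i\neq\alpha_{i+2}$ for each $i$. For $G\leqslant\mathrm{Aut}(\Gamma)$, the graph $\Gamma$ is locally $(G,s)$-arc-transitive if for each vertex $\alpha$ the stabiliser $G_\alpha$ acts transitively on the set of all $s$-arcs starting at $\alpha$. A permutation group is quasiprimitive on a set $\Omega$ if it acts faithfully on $\Omega$ and every nontrivial normal subgroup is transitive on $\Omega$. Type PA: a group $G$ acting quasiprimitively on $\Omega$ has type PA if there is a $G$-invariant partition $\mathcal{B}$ of $\Omega$ such that $G$ acts faithfully on $\mathcal{B}$ and $\mathcal{B}$ can be identified with $\Delta^k$ for some set $\Delta$ and some $k\geqslant 2$ in such a way that $G\leqslant H\,\mathrm{wr}\,S_k$ acts in the usual product action of the wreath product on $\Delta^k$, where $H\leqslant\mathrm{Sym}(\Delta)$ is an almost simple group acting quasiprimitively on $\Delta$; moreover, if $T=\mathrm{soc}(H)$, then $G$ has a unique minimal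 normal subgroup $N=T^k$. Types of quasiprimitive groups are mutually exclusive, and the case of regular $N$ is type TW, so for type PA $N_\alpha\neq1$. Straight/twisted/nondiagonal: for $G$ of type PA, one may take a block $B=(\delta,\dots,\delta)\in\mathcal{B}=\Delta^k$, so that $N_B=R^k$ with $R=T_\delta$, and for $\alpha\in B$ the group $N_\alpha$ is a subdirect subgroup of $R^k$ (it projects onto $R$ in each coordinate). If $N_\alpha\cong R$, then $N_\alpha$ is a diagonal subgroup: there are automorphisms $\varphi_2,\dots,\varphi_k$ of $R$ with $N_\alpha=\{(t,t^{\varphi_2},\dots,t^{\varphi_k})\mid t\in R\}$. It is a straight diagonal subgroup if all $\varphi_i$ are trivial and a twisted diagonal subgroup if some $\varphi_i$ is nontrivial. If $N_\alpha\not\cong R$ it is a nondiagonal subgroup. The action of $G$ is said to be of straight diagonal, twisted diagonal or nondiagonal type according to the type of $N_\alpha$ (for such a choice of $\alpha$ and $B$; an action of straight diagonal type may, with a different choice of $\alpha$, also be viewed as twisted diagonal). *)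

(* Defs.v *)
From HB Require Import structures.
From mathcomp Require Import all_boot all_fingroup all_solvable.

Set Implicit Arguments.
Unset Strict Implicit.
Unset Printing Implicit Defensive.

Import GroupScope.

(* Permutations act on the right, as in MathComp: (g * h) x = h (g x). *)

Definition graph_aut (V : finType) (e : rel V) : {set {perm V}} :=
  [set g : {perm V} | [forall x, forall y, e (g x) (g y) == e x y]].

Definition valency (V : finType) (e : rel V) (v : V) : nat :=
  #|[set w | e v w]|.

Definition is_arc (V : finType) (e : rel V) (s : nat) (t : s.+1.-tuple V) :
    Prop :=
  forall i j : 'I_s.+1,
    (j = i.+1 :> nat -> e (tnth t i) (tnth t j)) /\
    (j = i.+2 :> nat -> tnth t i != tnth t j).

Definition locally_arc_transitive (V : finType) (e : rel V)
    (G : {group {perm V}}) (s : nat) : Prop :=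
  forall (a : V) (t u : s.+1.-tuple V),
    is_arc e t -> is_arc e u -> thead t = a -> thead u = a ->
    exists2 g : {perm V}, g \in 'C_G[a | 'P] & map_tuple g t = u.

Definition quasiprimitive (T : finType) (G : {group {perm T}})
    (Omega : {set T}) : Prop :=
  [/\ [acts G, on Omega | 'P], [faithful G, on Omega | 'P] &
    forall K : {group {perm T}},
      K <| G -> K :!=: 1 -> [transitive K, on Omega | 'P]].

Definition almost_simple (gT : finGroupType) (H : {group gT}) : Prop :=
  exists (sT : finGroupType) (S : {group sT}) (A : {group {perm sT}}),
    [/\ simple S, ~~ abelian S, conj_aut S @* S \subset A,
        A \subset Aut S & H \isog A].

Definition soc (gT : finGroupType) (G : {group gT}) : {group gT} :=
  <<\bigcup_(M : {group gT} | (M \subset G) && minnormal M G) M>>%G.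

Definition unique_minnormal (gT : finGroupType) (N G : {group gT}) : Prop :=
  [/\ N \subset G, minnormal N G &
    forall M : {group gT}, M \subset G -> minnormal M G -> M = N].

Section ProductAction.
Variables (D : finType) (k : nat).

(* The element (h_0, ..., h_(k-1)) s of Sym(D) wr S_k maps the point x of D^k
   to the point y with y_(s i) = h_i (x_i). *)
Definition wr_fun (h : {ffun 'I_k -> {perm D}}) (s : 'S_k)
    (x : {ffun 'I_k -> D}) : {ffun 'I_k -> D} :=
  [ffun i => h (s^-1 i) (x (s^-1 i))].

Lemma wr_fun_inj h s : injective (wr_fun h s).
Proof.
move=> x y /ffunP eq_xy; apply/ffunP=> i.
by have := eq_xy (s i); rewrite !ffunE permK => /perm_inj.
Qed.

Definition wr_perm h s : {perm {ffun 'I_k -> D}} := perm (@wr_fun_inj h s).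

Definition base_perm h := wr_perm h 1.

Definition wreath (H : {group {perm D}}) : {set {perm {ffun 'I_k -> D}}} :=
  [set wr_perm h s | h in ffun_on H, s in [set: 'S_k]].

Lemma wreath_group_set H : group_set (wreath H).
Proof.
apply/group_setP; split.
  apply/imset2P; exists [ffun=> 1] 1; rewrite ?inE //.
    by apply/ffun_onP=> i; rewrite ffunE.
  by apply/permP=> x; apply/ffunP=> i; rewrite perm1 permE !(ffunE, invg1, perm1).
move=> _ _ /imset2P[h s /ffun_onP Hh _ ->] /imset2P[h' s' /ffun_onP Hh' _ ->].
apply/imset2P; exists [ffun i => h i * h' (s i)] (s * s'); rewrite ?inE //.
  by apply/ffun_onP=> i; rewrite ffunE groupM.
apply/permP=> x; apply/ffunP=> i.
by rewrite permM !permE !ffunE invMg !permM permKV.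
Qed.
Canonical wreath_group H := Group (wreath_group_set H).

(* The direct power A^k, acting coordinatewise on D^k. *)
Definition power_set (A : {set {perm D}}) : {set {perm {ffun 'I_k -> D}}} :=
  [set base_perm h | h in ffun_on A].

(* {(t, ..., t) | t in A} *)
Definition straight_diagonal (A : {set {perm D}}) :
    {set {perm {ffun 'I_k -> D}}} :=
  [set base_perm [ffun=> t] | t in A].

Definition subdirect (S : {set {perm {ffun 'I_k -> D}}}) (A : {set {perm D}}) :
    Prop :=
  S \subset power_set A /\
  forall i : 'I_k, [set h i | h : {ffun 'I_k -> {perm D}} in
                                [pred h | base_perm h \in S]] = A.

End ProductAction.

(* A witness that the action of G on Omega is quasiprimitive of type PA.
   pa_block identifies Delta^k with the G-invariant partition pa_part of Omega,
   and pa_rho is the permutation action of G on Delta^k obtained by transport;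
   it is determined by pa_block through pa_rhoE.  The field pa_nonregular
   separates type PA from type TW. *)
Record PA_action (V : finType) (G : {group {perm V}}) (Omega : {set V}) := {
  pa_qprim : quasiprimitive G Omega;
  pa_k : nat;
  pa_k_ge2 : (2 <= pa_k)%N;
  pa_Delta : finType;
  pa_H : {group {perm pa_Delta}};
  pa_H_almost_simple : almost_simple pa_H;
  pa_H_qprim : quasiprimitive pa_H [set: pa_Delta];
  pa_part : {set {set V}};
  pa_partP : partition pa_part Omega;
  pa_part_acts : [acts G, on pa_part | 'P^*];
  pa_part_faithful : [faithful G, on pa_part | 'P^*];
  pa_block : {ffun 'I_pa_k -> pa_Delta} -> {set V};
  pa_block_inj : injective pa_block;
  pa_block_im : [set pa_block x | x : {ffun 'I_pa_k -> pa_Delta}] = pa_part;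
  pa_rho : {morphism G >-> {perm {ffun 'I_pa_k -> pa_Delta}}};
  pa_rhoE : forall g x, g \in G -> pa_block (pa_rho g x) = g @: pa_block x;
  pa_wreath : pa_rho @* G \subset wreath pa_k pa_H;
  pa_N : {group {perm V}};
  pa_N_min : unique_minnormal pa_N G;
  pa_N_power : pa_rho @* pa_N = power_set pa_k (soc pa_H);
  pa_nonregular : forall a, a \in Omega -> 'C_pa_N[a | 'P] :!=: 1
}.

Definition type_PA (V : finType) (G : {group {perm V}}) (Omega : {set V}) :
    Prop :=
  inhabited (PA_action G Omega).

Section DiagonalTypes.
Variables (V : finType) (G : {group {perm V}}) (Omega : {set V}).
Variable S : PA_action G Omega.

Definition pa_R (d : pa_Delta S) : {group {perm pa_Delta S}} :=
  'C_(soc (pa_H S))[d | 'P]%G.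

(* The image of N_a in Sym(Delta^k). *)
Definition pa_Na (a : V) : {group {perm {ffun 'I_(pa_k S) -> pa_Delta S}}} :=
  (pa_rho S @* 'C_(pa_N S)[a | 'P])%G.

(* The point a lies in the block (d, ..., d), and the identification of the
   partition with Delta^k has been chosen so that N_a is subdirect in R^k. *)
Definition pa_base_point (d : pa_Delta S) (a : V) : Prop :=
  a \in pa_block [ffun=> d] /\ subdirect (pa_Na a) (pa_R d).

End DiagonalTypes.

Definition straight_diagonal_type (V : finType) (G : {group {perm V}})
    (Omega : {set V}) : Prop :=
  exists (S : PA_action G Omega) (d : pa_Delta S) (a : V),
    pa_base_point d a /\
    pa_Na S a = straight_diagonal (pa_k S) (pa_R d) :> {set _}.

Definition nondiagonal_type (V : finType) (G : {group {perm V}})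
    (Omega : {set V}) : Prop :=
  exists (S : PA_action G Omega) (d : pa_Delta S) (a : V),
    pa_base_point d a /\ ~~ (pa_Na S a \isog pa_R d).

(* Main.v *)
(* Let X = Sym(n) fix two points q, r of a set D of n + 2 points, Y = Sym(n - 1)
   the stabiliser in X of a third point p, c a 3-cycle on {p, q, r}, and
   z = (q r), which is odd, centralises X and inverts c.  In Sym(D) wr S_4 let
   tw be the twisted shift (f_0, f_1, f_2, f_3) -> (f_3 ^ z, f_0, f_1, f_2).
   It has order 8, it centralises the diagonal copy of X, and it normalises the
   group E = 3^2 of the words (c^{w_0}, ..., c^{w_3}), for w in the tetracode,
   permuting the 8 nontrivial ones transitively.  The graph is the coset graph
   of L = diag(X) <tw> and R = E diag(Y) <tw> in Alt(D)^4 <tw>.  The arc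
   stabiliser is B = diag(Y) <tw>, so L acts on L / B as Sym(n) on n points, and
   R acts on R / B as 3^2 : 8 on 9 points; both actions are 2-transitive.  The
   intersection of L with Alt(D)^4 is the diagonal copy of the stabiliser of
   {q, r} in Alt(D).  The intersection of R with Alt(D)^4 projects onto the
   stabiliser of {p, q, r} in each coordinate, but not injectively, since some
   nonzero codewords vanish there. *)
Require Import Defs.
From HB Require Import structures.
From mathcomp Require Import all_boot all_fingroup all_solvable.

Set Implicit Arguments.
Unset Strict Implicit.
Unset Printing Implicit Defensive.

Import GroupScope.

(** * Wreath products *)

(** Reduces uniqueness of the minimal normal subgroup to one containment, which is verified twice:
    for the almost simple group on a coset space and for the group of the graph. *)
Lemma minnormal_monolith (gT : finGroupType) (H U : {group gT}) :
    U <| H -> U :!=: 1 ->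
    (forall K : {group gT}, K \subset H -> H \subset 'N(K) -> K :!=: 1 ->
       U \subset K) ->
  unique_minnormal U H /\ soc H = U.
Proof.
move=> /andP[sUH nUH] ntU minU.
have mnU: minnormal U H.
  apply/mingroupP; split=> [|K /andP[ntK nKH] sKU]; first exact/andP.
  by apply/eqP; rewrite eqEsubset sKU minU // (subset_trans sKU).
have uniqU (M : {group gT}) : M \subset H -> minnormal M H -> M = U.
  move=> sMH /mingroupP[/andP[ntM nMH] minM]; apply/val_inj/esym/minM.
    exact/andP.
  exact: minU.
split=> //; apply/val_inj/eqP; rewrite eqEsubset gen_subG; apply/andP; split.
  by apply/bigcupsP=> M /andP[sMH mnM]; rewrite (uniqU M).
by apply: sub_gen; apply: (bigcup_sup U); rewrite //= sUH.
Qed.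

Section WreathType.
Variables (k : nat) (gT : finGroupType).

(* The pair (h, s) stands for the element (h_0, ..., h_(k-1)) s of gT wr S_k,
   with the product of [wr_perm]. *)
Definition wr := ({ffun 'I_k -> gT} * 'S_k)%type.
HB.instance Definition _ := Finite.on wr.

Definition wr_mul (x y : wr) : wr :=
  ([ffun i => x.1 i * y.1 (x.2 i)], x.2 * y.2).
Definition wr_one : wr := ([ffun=> 1], 1).
Definition wr_inv (x : wr) : wr := ([ffun i => (x.1 (x.2^-1 i))^-1], x.2^-1).

Fact wr_mulA : associative wr_mul.
Proof.
move=> x y z; congr pair => /=; last exact: mulgA.
by apply/ffunP=> i; rewrite !ffunE /= mulgA permM.
Qed.

Fact wr_mul1 : left_id wr_one wr_mul.
Proof.
case=> h s; congr pair => /=; last exact: mul1g.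
by apply/ffunP=> i; rewrite !ffunE /= mul1g perm1.
Qed.

Fact wr_mulV : left_inverse wr_one wr_inv wr_mul.
Proof.
case=> h s; congr pair => /=; last exact: mulVg.
by apply/ffunP=> i; rewrite !ffunE /= mulVg.
Qed.

HB.instance Definition _ := Finite_isGroup.Build wr wr_mulA wr_mul1 wr_mulV.

Lemma wr_mul1E (x y : wr) i : (x * y).1 i = x.1 i * y.1 (x.2 i).
Proof. by rewrite /mulg /= ffunE. Qed.

Lemma wr_mul2E (x y : wr) : (x * y).2 = x.2 * y.2.
Proof. by []. Qed.

Lemma wr_one1E i : (1 : wr).1 i = 1.
Proof. by rewrite /= ffunE. Qed.

Lemma wr_one2E : (1 : wr).2 = 1.
Proof. by []. Qed.

Lemma wr_inv1E (x : wr) i : (x^-1).1 i = (x.1 (x.2^-1 i))^-1.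
Proof. by rewrite /invg /= ffunE. Qed.

Lemma wr_inv2E (x : wr) : (x^-1).2 = x.2^-1.
Proof. by []. Qed.

Definition wrE := (wr_mul1E, wr_mul2E, wr_one1E, wr_one2E, wr_inv1E, wr_inv2E).

Lemma wrP (x y : wr) : x.1 =1 y.1 -> x.2 = y.2 -> x = y.
Proof. by case: x y => [h s] [h' s'] /= /ffunP-> ->. Qed.

Definition wr_base (A : {set gT}) : {set wr} :=
  [set x : wr | (x.2 == 1) && [forall i, x.1 i \in A]].

Lemma wr_baseP (A : {set gT}) (x : wr) :
  reflect (x.2 = 1 /\ forall i, x.1 i \in A) (x \in wr_base A).
Proof.
rewrite inE; apply: (iffP andP) => [[/eqP-> /forallP]|[-> Ax]] //.
by split=> //; apply/forallP.
Qed.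

Lemma wr_base_group_set (A : {group gT}) : group_set (wr_base A).
Proof.
apply/group_setP; split=> [|x y /wr_baseP[x2 Ax] /wr_baseP[y2 Ay]].
  by apply/wr_baseP; split=> // i; rewrite !wrE.
apply/wr_baseP; rewrite !wrE x2 y2 mulg1; split=> // i.
by rewrite wrE x2 perm1 groupM.
Qed.
Canonical wr_base_group A := Group (wr_base_group_set A).

Definition wr_elt (i : 'I_k) (t : gT) : wr :=
  ([ffun j => if j == i then t else 1], 1).

Lemma wr_elt1E i t j : (wr_elt i t).1 j = if j == i then t else 1.
Proof. by rewrite ffunE. Qed.

Lemma wr_elt2E i t : (wr_elt i t).2 = 1.
Proof. by []. Qed.

Lemma wr_elt_in (A : {group gT}) i t : t \in A -> wr_elt i t \in wr_base A.
Proof.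
by move=> At; apply/wr_baseP; split=> // j; rewrite wr_elt1E; case: eqP.
Qed.

Lemma wr_eltM i : {morph wr_elt i : t u / t * u}.
Proof.
move=> t u; apply: wrP => [j|]; last by rewrite wrE !wr_elt2E mulg1.
by rewrite wrE !wr_elt1E perm1; case: eqP; rewrite ?mulg1.
Qed.

Lemma wr_eltJ i t (g : wr) : wr_elt i t ^ g = wr_elt (g.2 i) (t ^ g.1 i).
Proof.
apply: (mulgI g); rewrite -conjgC.
apply: wrP => [j|]; last by rewrite !wrE !wr_elt2E mulg1 mul1g.
rewrite !wrE !wr_elt1E wr_elt2E perm1 (inj_eq perm_inj).
by case: eqP => [->|_]; rewrite ?mulg1 ?mul1g // -conjgC.
Qed.

Lemma wr_eltV i t : wr_elt i t^-1 = (wr_elt i t)^-1.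
Proof.
apply: (mulgI (wr_elt i t)); rewrite mulgV -wr_eltM mulgV.
by apply: wrP => // j; rewrite wr_elt1E wrE if_same.
Qed.

Lemma wr_base_gen (A : {group gT}) (P : {group wr}) :
  (forall i t, t \in A -> wr_elt i t \in P) -> wr_base A \subset P.
Proof.
move=> AP; apply/subsetP=> x /wr_baseP[x2 Ax].
have ->: x = \prod_(i <- enum 'I_k) wr_elt i (x.1 i).
  have prod2 s : (\prod_(i <- s) wr_elt i (x.1 i)).2 = 1.
    by elim: s => [|i s IHs]; rewrite ?big_nil // big_cons wrE IHs mulg1.
  apply: wrP => [j|]; last by rewrite prod2.
  have prod1 s : uniq s -> (\prod_(i <- s) wr_elt i (x.1 i)).1 j
                            = if j \in s then x.1 j else 1.
    elim: s => [|i s IHs] /=; first by rewrite big_nil wrE.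
    case/andP=> s'i /IHs{}IHs;
      rewrite big_cons wrE wr_elt2E perm1 IHs wr_elt1E inE.
    by case: eqP => [->|_] /=; rewrite ?(negPf s'i) ?mulg1 ?mul1g.
  by rewrite prod1 ?enum_uniq // mem_enum.
by rewrite big_seq; apply: group_prod => i _; apply: AP.
Qed.

(* A nontrivial normal subgroup meets T^k, hence by taking a commutator with a
   suitable element it meets, and so contains, a coordinate subgroup T. *)
Lemma wr_base_min (T : {group gT}) (Gam K : {group wr}) :
    simple T -> ~~ abelian T -> T <| [set: gT] -> 'C(T) = 1 ->
    wr_base T \subset Gam ->
    (forall i j, exists2 g, g \in Gam & g.2 i = j) ->
    Gam \subset 'N(K) -> K :!=: 1 -> wr_base T \subset K.
Proof.
move=> simT nabT /normal_norm nT cT1 sNG trG nKG ntK.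
have conjK x g : x \in K -> g \in Gam -> x ^ g \in K.
  by move=> Kx Gg; rewrite memJ_norm ?(subsetP nKG).
have comK x g : x \in K -> g \in Gam -> [~ x, g] \in K.
  by move=> Kx Gg; rewrite commgEl groupM ?groupV ?conjK.
have eltG i t : t \in T -> wr_elt i t \in Gam.
  by move=> Tt; rewrite (subsetP sNG) ?wr_elt_in.
have ntT : exists2 t, t \in T & t != 1.
  by apply/trivgPn; apply: contraNneq nabT => ->; apply: abelian1.
have cent_ex (u : gT) : u != 1 -> exists2 t, t \in T & [~ u, t] != 1.
  move=> ntu; apply/exists_inP; apply: contraNT ntu => /exists_inPn cu.
  rewrite -[u == 1]in_set1 -[[set _]]/(1%g : {set gT}) -cT1.
  by apply/centP=> t Tt; apply/commgP; have := cu t Tt; rewrite negbK.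
have [x Kx [x2 [i xi]]]: exists2 x : wr, x \in K & x.2 = 1 /\ exists i, x.1 i
  != 1.
  have [x Kx ntx] := trivgPn _ ntK.
  have [x2|x2] := eqVneq x.2 1.
    exists x => //; split=> //; apply/existsP.
    apply: contraNT ntx => /existsPn x1; apply/eqP/wrP; rewrite ?x2 // => i.
    by rewrite wrE; apply/eqP; have := x1 i; rewrite negbK.
  have /existsP[i xi]: [exists i, x.2 i != i].
    apply: contraNT x2 => /existsPn x1; apply/eqP/permP=> i.
    by rewrite perm1; apply/eqP; have := x1 i; rewrite negbK.
  have [t Tt nt] := ntT.
  (* As [x] moves [i], the factors [wr_elt i t^-1 ^ x] and [wr_elt i t] of the commutator live in
     different coordinates, so its entry at [i] is [t]. *)
  exists [~ x, wr_elt i t]; first by rewrite comK ?eltG.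
  rewrite commgEr -wr_eltV wr_eltJ; split; first by rewrite wrE !wr_elt2E mulg1.
  exists i; rewrite !wrE !wr_elt2E perm1 !wr_elt1E eqxx [i == _]eq_sym (negPf
    xi).
  by rewrite mul1g.
have [t Tt nt] := cent_ex _ xi.
(* The elements of T that K contains in coordinate [i] form a normal subgroup of T. It contains the
   nontrivial commutator of [x.1 i] with [t], so simplicity makes it all of T. *)
pose Q := [set u in T | wr_elt i u \in K].
have gQ : group_set Q.
  apply/group_setP; split=> [|u v].
    rewrite inE group1 (_ : wr_elt i 1 = 1) ?group1 //.
    by apply: wrP => // j; rewrite wr_elt1E wrE if_same.
  by rewrite !inE wr_eltM => /andP[Tu Ku] /andP[Tv Kv]; rewrite !groupM.
have nQ: Group gQ <| T.
  apply/normalP; split=> [|v Tv]; first by apply/subsetP=> u;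
    rewrite inE => /andP[].
  apply/eqP; rewrite eqEcard cardJg leqnn andbT;
    apply/subsetP=> _ /imsetP[u Qu ->].
  move: Qu; rewrite !inE => /andP[Tu Ku]; rewrite groupJ //=.
  suff <-: wr_elt i u ^ wr_elt i v = wr_elt i (u ^ v) by rewrite conjK ?eltG.
  by rewrite wr_eltJ wr_elt2E perm1 wr_elt1E eqxx.
have ntQ: Group gQ :!=: 1.
  apply/trivgPn; exists [~ x.1 i, t] => //.
  have xel: [~ x, wr_elt i t] = wr_elt i [~ x.1 i, t].
    by rewrite !commgEr -wr_eltV wr_eltJ x2 perm1 -wr_eltM.
  rewrite inE -xel comK ?eltG ?andbT //.
  by rewrite commgEr groupM // memJ_norm ?groupV // (subsetP nT) ?inE.
have QT: Group gQ :=: T.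
  by case/simpleP: simT => _ simT; case: (simT _ nQ) => // /eqP;
    rewrite (negPf ntQ).
have KT j u : u \in T -> wr_elt j u \in K.
  have [g Gg <-] := trG i j; rewrite -{1}(normsP nT (g.1 i)) ?inE //.
  case/imsetP=> v; rewrite -QT inE => /andP[_ Kv] ->.
  by rewrite -wr_eltJ conjK.
exact: wr_base_gen KT.
Qed.

End WreathType.

(** * Product actions on cosets *)

Section CosetPoints.
Variables (gT : finGroupType) (M : {group gT}).

(** The set Delta of type PA as a finite type: right cosets of [M] under right multiplication. The
    coset [M] itself will be the point delta. *)
Definition coset_pt := {A : {set gT} | A \in rcosets M [set: gT]}.

Fact base_pt_mem : (M : {set gT}) \in rcosets M [set: gT].
Proof. by apply/rcosetsP; exists 1; rewrite ?inE ?rcoset1. Qed.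

Definition base_pt : coset_pt := Sub (M : {set gT}) base_pt_mem.

Fact coset_pt_mem (A : coset_pt) g : val A :* g \in rcosets M [set: gT].
Proof.
case: A => _ /= /rcosetsP[x _ ->].
by rewrite -rcosetM; apply/rcosetsP; exists (x * g); rewrite ?inE.
Qed.

Definition coset_pt_act g (A : coset_pt) : coset_pt :=
  Sub (val A :* g) (coset_pt_mem A g).

Fact coset_pt_act_inj g : injective (coset_pt_act g).
Proof. by move=> A B /(congr1 val)/=/rcoset_inj/val_inj. Qed.

Definition coset_perm g := perm (@coset_pt_act_inj g).

Lemma val_coset_perm g A : val (coset_perm g A) = val A :* g.
Proof. by rewrite permE. Qed.

Fact coset_permM : {in [set: gT] &, {morph coset_perm : g h / g * h}}.
Proof.
move=> g h _ _; apply/permP=> A; apply: val_inj.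
by rewrite permM !val_coset_perm rcosetM.
Qed.
Canonical coset_perm_morphism := Morphism coset_permM.

Lemma coset_perm_base g : (coset_perm g base_pt == base_pt) = (g \in M).
Proof.
rewrite -val_eqE val_coset_perm /=.
by apply/eqP/idP => [<-|/rcoset_id//]; apply: rcoset_refl.
Qed.

(** The factorisation is transitivity of T on the cosets: if x^-1 = t m, then M x = M t^-1. *)
Lemma coset_perm_trans (T : {group gT}) (A : coset_pt) :
  T * M = [set: gT] -> exists2 t, t \in T & A = coset_perm t base_pt.
Proof.
move=> TM; case: A => A PA; have /rcosetsP[x _ defA] := PA.
have: x^-1 \in T * M by rewrite TM inE.
case/mulsgP=> t m Tt Mm defx; exists t^-1; rewrite ?groupV //.
apply: val_inj; rewrite val_coset_perm /= defA -[x]invgK defx invMg rcosetM.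
by rewrite rcoset_id ?groupV.
Qed.

Variable T : {group gT}.
Hypotheses (simT : simple T) (nabT : ~~ abelian T) (nT : T <| [set: gT]).
Hypotheses (cT1 : 'C(T) = 1) (TM : T * M = [set: gT]) (T'M : ~~ (T \subset M)).

(** By simplicity K meets T in 1 or in T. In the first case [K, T] lies in the intersection, so K
    centralises T and is trivial. *)
Lemma simple_norm_min (K : {group gT}) :
  [set: gT] \subset 'N(K) -> K :!=: 1 -> T \subset K.
Proof.
move=> nK ntK; have nKA := subset_trans (subsetT _) nK.
have [_ nT'] := andP nT; have nTA := subset_trans (subsetT _) nT'.
have nKT : (K :&: T)%G <| T by rewrite /normal subsetIr normsI ?normG.
case/simpleP: simT => _ /(_ _ nKT)[] KT; last by rewrite -KT subsetIl.
case/negP: ntK; rewrite -subG1 -cT1; apply/commG1P/trivgP.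
by rewrite -[1]KT subsetI commg_subl commg_subr !nKA !nTA.
Qed.

(** A nontrivial kernel would contain T, but the kernel fixes the coset [M], so T would lie in
    [M]. *)
Lemma coset_perm_injm : 'injm coset_perm.
Proof.
apply: contraR T'M; rewrite subG1 => ntK.
have sTK: T \subset 'ker coset_perm by apply: simple_norm_min;
  rewrite ?ker_norm.
apply/subsetP=> t /(subsetP sTK) /mker t1.
by rewrite -coset_perm_base t1 perm1.
Qed.

Let H := (coset_perm @* [set: gT])%G.

Lemma coset_perm_min (K : {group {perm coset_pt}}) :
  K \subset H -> H \subset 'N(K) -> K :!=: 1 -> coset_perm @* T \subset K.
Proof.
move=> sKH nKH ntK; rewrite sub_morphim_pre ?subsetT //.
apply: (simple_norm_min (K := coset_perm @*^-1 K)%G).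
  by apply: subset_trans (morphpre_norms _ nKH); rewrite -sub_morphim_pre.
by apply: contraNneq ntK => /= K1; rewrite -(morphpreK sKH) K1 morphim1.
Qed.

Lemma coset_perm_monolith :
  unique_minnormal (coset_perm @* T)%G H /\ soc H = (coset_perm @* T)%G.
Proof.
apply: minnormal_monolith => [||K]; first exact: morphim_normal.
  rewrite morphim_injm_eq1 ?subsetT ?coset_perm_injm //.
  by apply: contraNneq nabT => ->; apply: abelian1.
exact: coset_perm_min.
Qed.

Lemma coset_perm_quasiprimitive : quasiprimitive H [set: coset_pt].
Proof.
split.
- by apply/actsP=> h _ A; rewrite !inE.
- apply/faithfulP=> h _ h1; apply/permP=> A.
  by rewrite perm1; apply: h1; rewrite inE.
move=> K /andP[sKH nKH] ntK; have sTK := coset_perm_min sKH nKH ntK.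
apply/imsetP; exists base_pt; rewrite ?inE //.
apply/setP=> A; rewrite inE; apply/esym/imsetP.
have [t Tt ->] := coset_perm_trans A TM.
by exists (coset_perm t); rewrite ?(subsetP sTK) ?mem_morphim ?inE.
Qed.

(** Conjugation on T embeds the whole group into Aut(T), because the centraliser of T is trivial. *)
Lemma coset_perm_almost_simple : almost_simple H.
Proof.
have nT' : [set: gT] \subset 'N(T) by case/andP: nT.
exists gT, T, (conj_aut T @* [set: gT])%G; split=> //.
- by rewrite morphimS ?subsetT.
- exact: Aut_conj_aut.
apply: isog_trans (_ : [set: gT] \isog _).
  by rewrite isog_sym; apply: sub_isog; rewrite ?coset_perm_injm.
by apply: sub_isog => //; rewrite ker_conj_aut cT1.
Qed.

Lemma coset_perm_stab :
  'C_(soc H)[base_pt | 'P] = coset_perm @* (T :&: M).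
Proof.
have [_ ->] := coset_perm_monolith; apply/setP=> h; apply/setIP/morphimP.
  case=> /morphimP[t _ Tt ->] /astab1P/eqP; rewrite coset_perm_base => Mt.
  by exists t; rewrite ?inE ?Tt.
case=> t _ /setIP[Tt Mt] ->; split.
  by apply: mem_morphim; rewrite ?inE.
by apply/astab1P/eqP; rewrite [aperm _ _ == _]coset_perm_base.
Qed.

End CosetPoints.

Lemma base_perm_inj (D : finType) (k : nat) : injective (@base_perm D k).
Proof.
move=> h h' eq_h; apply/ffunP=> i; apply/permP=> d.
have /ffunP/(_ i) := congr1 (fun s : {perm _} => s [ffun=> d]) eq_h.
by rewrite !permE !ffunE invg1 perm1.
Qed.

(** * Type PA for subgroups of a wreath product *)

Section ProductActionType.
Variables (k : nat) (gT : finGroupType) (T M : {group gT}).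
Variables (Gam L : {group wr k gT}) (V : finType).
Variables (q : {morphism Gam >-> {perm V}}) (a0 : V).

Hypothesis k_ge2 : (2 <= k)%N.
Hypotheses (simT : simple T) (nabT : ~~ abelian T) (nT : T <| [set: gT]).
Hypotheses (cT1 : 'C(T) = 1) (TM : T * M = [set: gT]) (T'M : ~~ (T \subset M)).
Hypothesis sNG : wr_base k T \subset Gam.
Hypothesis nNG : Gam \subset 'N(wr_base k T).
Hypothesis trG : forall i j : 'I_k, exists2 g, g \in Gam & g.2 i = j.
(** [L] is the stabiliser of [a0] and lies in M wr S_k, which fixes the constant point of Delta^k.
    [GNL] makes N transitive on the orbit of [a0], and [projL] makes the stabiliser of [a0] in N
    subdirect in R^k, where R is the intersection of T and M. *)
Hypothesis stabL : forall g, g \in Gam -> (q g a0 == a0) = (g \in L).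
Hypothesis sLG : L \subset Gam.
Hypothesis sLM : forall g i, g \in L -> g.1 i \in M.
Hypothesis GNL : Gam \subset wr_base k T * L.
Hypothesis projL : forall i t, t \in T -> t \in M ->
  exists2 g, g \in L :&: wr_base k T & g.1 i = t.
Hypothesis ntLN : L :&: wr_base k T != 1.

Let N := wr_base k T.
Let G := (q @* Gam)%G.
Let Omega := [set q g a0 | g in Gam].
Let Delta := coset_pt M.
Let pt := {ffun 'I_k -> Delta}.
Let H := (@coset_perm _ M @* [set: gT])%G.

Definition wr_rho (g : wr k gT) : {perm pt} :=
  wr_perm [ffun i => coset_perm M (g.1 i)] g.2.

Fact wr_rhoM : {in Gam &, {morph wr_rho : g h / g * h}}.
Proof.
move=> g h _ _; apply/permP=> x; apply/ffunP=> i; rewrite permM !permE !ffunE.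
by rewrite !wrE coset_permM ?inE // invMg !permM permKV.
Qed.
Canonical wr_rho_morphism := Morphism wr_rhoM.

Lemma wr_rhoE g (x : pt) i :
  wr_rho g x i = coset_perm M (g.1 (g.2^-1 i)) (x (g.2^-1 i)).
Proof. by rewrite permE !ffunE. Qed.

Let x0 : pt := [ffun=> base_pt M].

Lemma wr_rho_stab g : g \in L -> wr_rho g x0 = x0.
Proof.
move=> Lg; apply/ffunP=> i; rewrite wr_rhoE !ffunE; apply/eqP.
by rewrite coset_perm_base sLM.
Qed.

Lemma wr_base_notin_L : ~~ (N \subset L).
Proof.
apply: contra T'M => /subsetP sNL; apply/subsetP=> t Tt.
have i : 'I_k by exists 0; apply: leq_trans k_ge2.
have Lt := sNL _ (wr_elt_in i Tt).
by have:= sLM i Lt; rewrite wr_elt1E eqxx.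
Qed.

(** If K were nontrivial it would contain N, so N would lie in [L], and reading off a coordinate
    would put T inside M. *)
Lemma pa_norm_L_triv (K : {group wr k gT}) :
  Gam \subset 'N(K) -> (forall g, g \in K -> g \in N -> g \in L) -> K :=: 1.
Proof.
move=> nKG KNL; apply/eqP; apply: contraR wr_base_notin_L => ntK.
have /subsetP sNK := wr_base_min simT nabT nT cT1 sNG trG nKG ntK.
by apply/subsetP=> g Ng; apply: KNL; rewrite ?sNK.
Qed.

Lemma pa_q_injm : 'injm q.
Proof.
rewrite subG1; apply/eqP; apply: (pa_norm_L_triv (K := 'ker q)%G).
  exact: ker_norm.
move=> g /mker q1 Ng; rewrite -stabL ?q1 ?perm1 //.
exact: (subsetP sNG).
Qed.

Lemma wr_rho_injm : 'injm wr_rho_morphism.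
Proof.
rewrite subG1; have nK := ker_norm wr_rho_morphism.
apply: contraR T'M => ntK.
have /subsetP sNK := wr_base_min simT nabT nT cT1 sNG trG nK ntK.
apply/subsetP=> t Tt.
have i : 'I_k by exists 0; apply: leq_trans k_ge2.
have /mker/permP/(_ x0)/ffunP/(_ i)/eqP := sNK _ (wr_elt_in i Tt).
rewrite perm1 [wr_rho_morphism _ _ _]wr_rhoE wr_elt2E invg1 perm1 wr_elt1E eqxx.
by rewrite ffunE coset_perm_base.
Qed.

(** [G] consists of permutations of [V], so the product action of [Gam] must be factored through
    [q]; injectivity of [q] allows this. *)
Definition pa_morph := factm_morphism (subset_trans pa_q_injm (sub1G _) :
  'ker q \subset 'ker wr_rho_morphism) (subxx Gam).

Lemma pa_morphE g : g \in Gam -> pa_morph (q g) = wr_rho g.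
Proof. exact: factmE. Qed.

Lemma pa_morph_im (A : {set wr k gT}) : pa_morph @* (q @* A) = wr_rho_morphism
  @* A.
Proof. exact: morphim_factm. Qed.

Lemma pa_q_min (K : {group {perm V}}) :
  K \subset G -> G \subset 'N(K) -> K :!=: 1 -> q @* N \subset K.
Proof.
move=> sKG nKG ntK; rewrite sub_morphim_pre //.
apply: (wr_base_min (K := q @*^-1 K)%G simT nabT nT cT1 sNG trG).
  by apply: subset_trans (morphpre_norms _ nKG); rewrite -sub_morphim_pre.
by apply: contraNneq ntK => /= K1; rewrite -(morphpreK sKG) K1 morphim1.
Qed.

Lemma wr_base_nt : N != 1.
Proof. by apply: contraNneq ntLN => N1;
  rewrite -/N N1 (setIidPr (sub1G L)). Qed.

Lemma pa_q_monolith :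
  unique_minnormal (q @* N)%G G /\ soc G = (q @* N)%G.
Proof.
apply: minnormal_monolith => [||K]; last exact: pa_q_min.
  by rewrite morphim_normal // /normal sNG.
by rewrite morphim_injm_eq1 ?pa_q_injm ?wr_base_nt.
Qed.

Lemma Gam_L_N_mul g : g \in Gam ->
  exists l n, [/\ l \in L, n \in N & g = l * n].
Proof.
move=> Gg; have: g^-1 \in N * L by rewrite (subsetP GNL) ?groupV.
case/mulsgP=> n l Nn Ll def; exists l^-1, n^-1.
by rewrite !groupV -invMg -def invgK.
Qed.

(** The block over [x]: the fibre of the map from the orbit of [a0] to Delta^k sending [q g a0] to
    [wr_rho g x0], which is well defined because [L] fixes [x0]. *)
Definition pa_fiber (x : pt) : {set V} :=
  [set q g a0 | g in [set g in Gam | wr_rho g x0 == x]].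

Lemma pa_fiberP x v :
  reflect (exists2 g, g \in Gam & wr_rho g x0 = x /\ v = q g a0) (v \in
    pa_fiber x).
Proof.
apply: (iffP imsetP) => [[g /setIdP[Gg /eqP gx] ->]|[g Gg [gx ->]]];
  exists g => //.
by rewrite inE Gg gx /=.
Qed.

Lemma pa_q_rho g h : g \in Gam -> h \in Gam -> q g a0 = q h a0 ->
  wr_rho g x0 = wr_rho h x0.
Proof.
move=> Gg Gh eqa; have Lgh: g * h^-1 \in L.
  by rewrite -stabL ?groupM ?groupV // morphM ?groupV // morphV // permM eqa
    permK.
rewrite -[g](mulgKV h) wr_rhoM ?groupM ?groupV // permM.
by rewrite wr_rho_stab.
Qed.

Lemma pa_q_fiber g x : g \in Gam ->
  (q g a0 \in pa_fiber x) = (wr_rho g x0 == x).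
Proof.
move=> Gg; apply/pa_fiberP/eqP => [[h Gh [<- /pa_q_rho->]] //|<-].
by exists g.
Qed.

Lemma wr_rho_trans x : exists2 g, g \in N & wr_rho g x0 = x.
Proof.
have ht i : {t | t \in T & x i = coset_perm M t (base_pt M)}.
  by apply: sig2_eqW; apply: coset_perm_trans.
pose g : wr k gT := ([ffun i => s2val (ht i)], 1).
exists g; first by apply/wr_baseP; split=> // i; rewrite ffunE; case: (ht i).
apply/ffunP=> i; rewrite wr_rhoE invg1 perm1 !ffunE; by case: (ht i).
Qed.

Lemma pa_fiber_inj : injective pa_fiber.
Proof.
move=> x y eqxy; have [g Ng gx] := wr_rho_trans x.
have Gg := subsetP sNG _ Ng.
have: q g a0 \in pa_fiber x by rewrite pa_q_fiber ?gx.
by rewrite eqxy pa_q_fiber // gx => /eqP.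
Qed.

Lemma pa_fiberJ g x : g \in G -> pa_fiber (pa_morph g x) = g @: pa_fiber x.
Proof.
have sub (h : wr k gT) y : h \in Gam ->
  q h @: pa_fiber y \subset pa_fiber (wr_rho h y).
  move=> Gh; apply/subsetP=> _ /imsetP[_ /pa_fiberP[g' Gg' [<- ->]] ->].
  by rewrite -permM -morphM // pa_q_fiber ?groupM // wr_rhoM // permM.
case/morphimP=> h Gh _ ->{g}; rewrite pa_morphE //.
apply/eqP; rewrite eqEsubset sub // andbT; apply/subsetP=> v v_in.
have: q h^-1 v \in pa_fiber x.
  rewrite -[x](permK (wr_rho h)) -(morphV wr_rho_morphism) //=.
  by apply: (subsetP (sub _ _ _)); rewrite ?groupV // imset_f.
by move=> v'_in; apply/imsetP; exists (q h^-1 v); rewrite // morphV // permKV.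
Qed.

Let part := [set pa_fiber x | x : pt].

Lemma pa_fiber_part : partition part Omega.
Proof.
have cov: cover part = Omega.
  apply/setP=> v; apply/bigcupP/imsetP => [[_ /imsetP[x _ ->]]|[g Gg ->]].
    by case/pa_fiberP=> g Gg [_ ->]; exists g.
  by exists (pa_fiber (wr_rho g x0)); [exact: imset_f | rewrite pa_q_fiber].
apply/and3P; split; first by rewrite cov.
  apply/trivIsetP=> _ _ /imsetP[x _ ->] /imsetP[y _ ->] neq.
  rewrite -setI_eq0; apply: contraNT neq => /set0Pn[v /setIP[]].
  by case/pa_fiberP=> g Gg [<- ->]; rewrite pa_q_fiber // => /eqP->.
apply/imsetP=> -[x _ /esym/setP x0']; have [g Ng gx] := wr_rho_trans x.
by have:= x0' (q g a0); rewrite pa_q_fiber ?(subsetP sNG) // gx eqxx inE.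
Qed.

Lemma pa_part_actsG : [acts G, on part | 'P^*].
Proof.
apply/subsetP=> g Gg; rewrite !inE; apply/subsetP=> _ /imsetP[x _ ->].
rewrite inE; suff: g @: pa_fiber x \in part by [].
by rewrite -pa_fiberJ // imset_f.
Qed.

(** Fixing every block means acting trivially on Delta^k, where [wr_rho] is injective. This yields
    faithfulness both on the partition and on the points. *)
Lemma pa_fix_fibers g : g \in G ->
  (forall x, g @: pa_fiber x = pa_fiber x) -> g = 1.
Proof.
move=> Gg fixg; have: pa_morph g = 1.
  by apply/permP=> x; rewrite perm1; apply: pa_fiber_inj; rewrite pa_fiberJ.
case/morphimP: Gg => h Gh _ ->; rewrite pa_morphE // => h1.
rewrite (_ : h = 1) ?morph1 //; apply/set1P/(subsetP wr_rho_injm).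
by rewrite !inE Gh /= h1.
Qed.

Lemma pa_part_faithfulG : [faithful G, on part | 'P^*].
Proof.
apply/faithfulP=> g Gg fixg; apply: pa_fix_fibers => // x.
by apply: fixg; rewrite imset_f.
Qed.

(** A nontrivial normal subgroup contains the image of N, and N is transitive because [Gam] = L N
    with [L] fixing [a0]. *)
Lemma pa_quasiprimitive : quasiprimitive G Omega.
Proof.
split.
- apply/subsetP=> g Gg; rewrite !inE; apply/subsetP=> _ /imsetP[x Gx ->].
  case/morphimP: Gg => h Gh _ ->; rewrite inE /= apermE -permM -morphM //.
  by rewrite imset_f ?groupM.
- apply/faithfulP=> g Gg fixg; apply: pa_fix_fibers => // x.
  rewrite -[RHS]imset_id; apply: eq_in_imset => v /pa_fiberP[h Gh [_ ->]].
  by apply: fixg; rewrite imset_f.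
move=> K /andP[sKG nKG] ntK; have /subsetP sNK := pa_q_min sKG nKG ntK.
apply/imsetP; exists a0; first by apply/imsetP; exists 1;
  rewrite ?morph1 ?perm1.
apply/setP=> v; apply/imsetP/imsetP =>
  [[g /Gam_L_N_mul[l [n [Ll Nn ->]]] ->]|[g Kg ->]].
  have Gl := subsetP sLG _ Ll; have Gn := subsetP sNG _ Nn.
  exists (q n); first by rewrite sNK ?mem_morphim.
  by rewrite morphM // permM; move: Ll; rewrite -stabL // => /eqP->.
have /morphimP[h Gh _ ->] := subsetP sKG _ Kg.
by exists h.
Qed.

Lemma pa_rho_wreath : pa_morph @* G \subset wreath k H.
Proof.
rewrite /= pa_morph_im; apply/subsetP=> _ /morphimP[g _ Gg ->].
apply/imset2P; exists [ffun i => coset_perm M (g.1 i)] g.2; rewrite ?inE //.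
by apply/ffun_onP=> i; rewrite ffunE mem_morphim ?inE.
Qed.

Lemma wr_rho_base (g : wr k gT) : g \in N ->
  wr_rho g = base_perm [ffun i => coset_perm M (g.1 i)].
Proof. by case/wr_baseP=> g2 _; rewrite /wr_rho g2. Qed.

Lemma pa_N_powerG : pa_morph @* (q @* N) = power_set k (soc H).
Proof.
have [_ ->] := coset_perm_monolith simT nabT nT cT1 T'M.
rewrite pa_morph_im; apply/setP=> h; apply/morphimP/imsetP => [[g _ Ng ->]|].
  exists [ffun i => coset_perm M (g.1 i)]; last exact: wr_rho_base.
  apply/ffun_onP=> i; rewrite ffunE mem_morphim ?inE //.
  by case/wr_baseP: Ng.
case=> f /ffun_onP Tf ->.
have ht i : {t | t \in T & f i = coset_perm M t}.
  by apply: sig2_eqW; case/morphimP: (Tf i) => t _ Tt ->; exists t.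
pose g : wr k gT := ([ffun i => s2val (ht i)], 1).
have Ng: g \in N by apply/wr_baseP; split=> // i; rewrite ffunE; case: (ht i).
exists g => //; first exact: (subsetP sNG).
rewrite /= wr_rho_base //; congr base_perm; apply/ffunP=> i; rewrite !ffunE.
by case: (ht i).
Qed.

Lemma coset_stab_N : 'C_(q @* N)[a0 | 'P] = q @* (L :&: N).
Proof.
apply/setP=> g; apply/setIP/morphimP => [[/morphimP[h Gh Nh ->]]|[h Gh]].
  move/astab1P/eqP; rewrite /= apermE stabL // => Lh.
  by exists h => //; apply/setIP.
case/setIP=> Lh Nh ->; split; first exact: mem_morphim.
by apply/astab1P/eqP; rewrite /= apermE stabL.
Qed.

(** Since [Gam] normalises N, the point stabilisers in N are conjugate, so a nontrivial element of
    [L :&: N] can be moved to any point. *)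
Lemma pa_nonregularG a : a \in Omega -> 'C_(q @* N)[a | 'P] != 1.
Proof.
case/imsetP=> g Gg ->; have [h LNh nth] := trivgPn _ ntLN.
have [Lh Nh] := setIP LNh; have Gh := subsetP sNG _ Nh.
apply/trivgPn; exists (q (h ^ g)); last first.
  by rewrite morph_injm_eq1 ?pa_q_injm ?groupJ // conjg_eq1.
apply/setIP; split.
  by apply: mem_morphim; [rewrite groupJ | rewrite memJ_norm ?(subsetP nNG)].
apply/astab1P; rewrite /= apermE -permM -morphM ?groupJ // -conjgC morphM //
  permM.
by move: Lh; rewrite -stabL // => /eqP->.
Qed.

Definition coset_PA_action : PA_action G Omega :=
  @Build_PA_action V G Omega pa_quasiprimitive k k_ge2 Delta H
    (coset_perm_almost_simple simT nabT nT cT1 T'M)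
    (coset_perm_quasiprimitive simT nT cT1 TM) part pa_fiber_part
    pa_part_actsG pa_part_faithfulG pa_fiber pa_fiber_inj erefl pa_morph
    pa_fiberJ pa_rho_wreath (q @* N)%G (proj1 pa_q_monolith) pa_N_powerG
    pa_nonregularG.

Lemma coset_pa_Na : pa_Na coset_PA_action a0 = wr_rho_morphism @* (L :&: N) :>
  {set _}.
Proof. by rewrite /pa_Na /= coset_stab_N pa_morph_im. Qed.

Lemma coset_pa_R : pa_R (S :=
  coset_PA_action) (base_pt M) = coset_perm M @* (T :&: M) :> {set _}.
Proof. exact: coset_perm_stab. Qed.

Lemma coset_pa_NaP s : reflect
  (exists2 g, g \in L :&: N & s = base_perm [ffun i => coset_perm M (g.1 i)])
  (s \in pa_Na coset_PA_action a0).
Proof.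
rewrite coset_pa_Na; apply: (iffP morphimP) => [[g _ LNg ->]|[g LNg ->]].
  by exists g => //=; rewrite wr_rho_base //; case/setIP: LNg.
have [_ Ng] := setIP LNg; exists g; rewrite ?(subsetP sNG) //=.
by rewrite wr_rho_base.
Qed.

Lemma coset_pa_RP s : reflect
  (exists2 t, t \in T /\ t \in M & s = coset_perm M t)
  (s \in pa_R (S := coset_PA_action) (base_pt M)).
Proof.
rewrite coset_pa_R; apply: (iffP morphimP) => [[t _ /setIP[]]|[t [Tt Mt] ->]].
  by exists t.
by exists t; rewrite ?inE ?Tt.
Qed.

Lemma coset_L_N_coord g i : g \in L :&: N -> g.1 i \in T /\ g.1 i \in M.
Proof. by case/setIP=> Lg /wr_baseP[_ Tg]; rewrite sLM. Qed.

Lemma coset_pa_base_point : pa_base_point (S := coset_PA_action) (base_pt M) a0.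
Proof.
split.
  have ->: a0 = q 1 a0 by rewrite morph1 perm1.
  by rewrite /= pa_q_fiber ?wr_rho_stab.
split=> [|i].
  apply/subsetP=> _ /coset_pa_NaP[g LNg ->]; apply: imset_f.
  apply/ffun_onP=> j; rewrite ffunE; apply/coset_pa_RP.
  by exists (g.1 j); first exact: coset_L_N_coord.
apply/setP=> s; apply/imsetP/coset_pa_RP => [[h]|[t [Tt Mt] ->]].
  case/coset_pa_NaP=> g LNg /base_perm_inj-> ->; rewrite ffunE.
  by exists (g.1 i); first exact: coset_L_N_coord.
have [g LNg <-] := projL i Tt Mt.
exists [ffun i => coset_perm M (g.1 i)]; last by rewrite ffunE.
by apply/coset_pa_NaP; exists g.
Qed.

Lemma coset_straight :
  (forall g, g \in L :&: N -> forall i j, g.1 i = g.1 j) ->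
  straight_diagonal_type G Omega.
Proof.
move=> diagL; have i : 'I_k by exists 0; apply: leq_trans k_ge2.
exists coset_PA_action, (base_pt M), a0; split;
  first exact: coset_pa_base_point.
apply/setP=> s; apply/coset_pa_NaP/imsetP => [[g LNg ->]|[u]].
  exists (coset_perm M (g.1 i)).
    by apply/coset_pa_RP; exists (g.1 i); first exact: coset_L_N_coord.
  by congr base_perm; apply/ffunP=> j; rewrite !ffunE (diagL g LNg i j).
case/coset_pa_RP=> t [Tt Mt] -> ->; have [g LNg <-] := projL i Tt Mt.
exists g => //.
by congr base_perm; apply/ffunP=> j; rewrite !ffunE (diagL g LNg i j).
Qed.

(** Projection to coordinate [i] maps [L :&: N] onto a copy of R and has [g] in its kernel. Hence
    the stabiliser has larger order than R and is not isomorphic to it. *)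
Lemma coset_nondiagonal i g :
  g \in L :&: N -> g != 1 -> g.1 i = 1 -> nondiagonal_type G Omega.
Proof.
move=> LNg ntg gi1.
exists coset_PA_action, (base_pt M), a0; split;
  first exact: coset_pa_base_point.
apply: contra ntg => /card_isog;
  rewrite coset_pa_Na card_injm ?wr_rho_injm //; last first.
  by rewrite subIset ?sLG.
have -> : pa_R (S := coset_PA_action) (base_pt M)
        = [set coset_perm M (h.1 i) | h : wr k gT in L :&: N] :> {set _}.
  apply/setP=> s; apply/coset_pa_RP/imsetP => [[t [Tt Mt] ->]|[h LNh ->]].
    by have [h LNh <-] := projL i Tt Mt; exists h.
  by exists (h.1 i); first exact: coset_L_N_coord.
move/esym/eqP/imset_injP => inj; apply/eqP/inj; rewrite ?group1 //.
by rewrite gi1 wrE.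
Qed.

Lemma coset_type_PA : type_PA G Omega.
Proof. exact: (inhabits coset_PA_action). Qed.
End ProductActionType.

(** * Coset graphs *)

Section CosetGraph.
Variables (gT : finGroupType) (Gam : {group gT}) (S : bool -> {group gT}).
Hypothesis sSG : forall b, S b \subset Gam.
Hypothesis neqS : S true :!=: S false.

(** Vertices are bare cosets without a tag for the side; the side can be recovered because [S true]
    and [S false] differ. *)
Definition cg_vertex := {A : {set gT} | [exists b, A \in rcosets (S b) Gam]}.

Definition cg_adj : rel cg_vertex := fun A B =>
  [exists b, (val A \in rcosets (S b) Gam) && (val B \in rcosets (S (~~ b))
    Gam)]
  && (val A :&: val B != set0).

(** Elements outside [Gam] are made to act trivially, so that the action is total on [gT]. *)
Let dom g := if g \in Gam then g else 1.

Fact cg_act_mem (A : cg_vertex) g :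
  [exists b, val A :* dom g \in rcosets (S b) Gam].
Proof.
case: A => _ /= /existsP[b /rcosetsP[x Gx ->]]; apply/existsP; exists b.
rewrite -rcosetM; apply/rcosetsP; exists (x * dom g); rewrite // groupM //.
by rewrite /dom; case: ifP.
Qed.

Definition cg_act g (A : cg_vertex) : cg_vertex :=
  Sub (val A :* dom g) (cg_act_mem A g).

Fact cg_act_inj g : injective (cg_act g).
Proof. by move=> A B /(congr1 val)/=/rcoset_inj/val_inj. Qed.

Definition cg_perm g := perm (@cg_act_inj g).

Lemma val_cg_perm g A : g \in Gam -> val (cg_perm g A) = val A :* g.
Proof. by move=> Gg; rewrite permE /= /dom Gg. Qed.

Fact cg_permM : {in Gam &, {morph cg_perm : g h / g * h}}.
Proof.
move=> g h Gg Gh; apply/permP=> A; apply: val_inj.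
by rewrite permM !val_cg_perm ?groupM // rcosetM.
Qed.
Canonical cg_perm_morphism := Morphism cg_permM.

Fact cg_base_mem b : [exists c, (S b : {set gT}) \in rcosets (S c) Gam].
Proof.
by apply/existsP; exists b; apply/rcosetsP; exists 1; rewrite ?rcoset1.
Qed.

Definition cg_base b : cg_vertex := Sub (S b : {set gT}) (cg_base_mem b).

Definition cg_side b := [set cg_perm g (cg_base b) | g in Gam].

Lemma cg_base_stab b g :
  g \in Gam -> (cg_perm g (cg_base b) == cg_base b) = (g \in S b).
Proof.
move=> Gg; rewrite -val_eqE val_cg_perm //=.
by apply/eqP/idP => [<-|/rcoset_id//]; apply: rcoset_refl.
Qed.

Lemma cg_base_perm b g : g \in S b -> cg_perm g (cg_base b) = cg_base b.
Proof. by move=> Sg; apply/eqP; rewrite cg_base_stab // (subsetP (sSG b)). Qed.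

(** A common coset S_b x = S_c y contains x, so it is also S_c x; cancelling x gives S_b = S_c. *)
Lemma rcosets_side A b c :
  A \in rcosets (S b) Gam -> A \in rcosets (S c) Gam -> b = c.
Proof.
case/rcosetsP=> x _ -> /rcosetsP[y _ eqxy].
have /rcoset_eqP eqx: x \in S c :* y by rewrite -eqxy rcoset_refl.
move: eqxy neqS; rewrite -eqx => /rcoset_inj.
by case: b; case: c {eqx} => // ->; rewrite eqxx.
Qed.

Lemma cg_vertexP v : exists b g, g \in Gam /\ v = cg_perm g (cg_base b).
Proof.
case: v => A PA; have /existsP[b /rcosetsP[g Gg defA]] := PA.
by exists b, g; split=> //; apply: val_inj; rewrite val_cg_perm.
Qed.

Lemma val_cg_base_side b g :
  g \in Gam -> val (cg_perm g (cg_base b)) \in rcosets (S b) Gam.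
Proof. by move=> Gg; rewrite val_cg_perm //; apply/rcosetsP; exists g. Qed.

Lemma cg_adj_sym : symmetric cg_adj.
Proof.
move=> A B; rewrite /cg_adj setIC; congr (_ && _).
by apply/existsP/existsP=> -[b /andP[Ab Bb]]; exists (~~ b);
  rewrite negbK Ab Bb.
Qed.

Lemma cg_adj_irr : irreflexive cg_adj.
Proof.
move=> A; apply/andP=> -[/existsP[b /andP[Ab Ab']] _].
by have := rcosets_side Ab Ab'; case: (b).
Qed.

Lemma cg_adj_perm g : g \in Gam ->
  forall A B, cg_adj (cg_perm g A) (cg_perm g B) = cg_adj A B.
Proof.
have mem b A h : h \in Gam ->
    (val (cg_perm h A) \in rcosets (S b) Gam) = (val A \in rcosets (S b) Gam).
  move=> Gh; rewrite val_cg_perm //.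
  apply/rcosetsP/rcosetsP=> -[x Gx] => [eqA | ->]; last first.
    by exists (x * h); rewrite ?groupM // rcosetM.
  by exists (x * h^-1);
    rewrite ?groupM ?groupV // rcosetM -eqA -rcosetM mulgV rcoset1.
move=> Gg A B; rewrite /cg_adj; congr (_ && _).
  by apply: eq_existsb => b; rewrite !mem.
rewrite !val_cg_perm // -!rcosetE -imsetI ?imset_eq0 //.
by apply: in2W; apply: mulIg.
Qed.

Lemma cg_adj_baseP b w : reflect
  (exists2 l, l \in S b & w = cg_perm l (cg_base (~~ b))) (cg_adj (cg_base b)
    w).
Proof.
apply: (iffP andP) => [[/existsP[c /andP[bc wc]] /set0Pn[x /setIP[Sx wx]]]|].
  have Gx := subsetP (sSG b) _ Sx.
  have bs : val (cg_base b) \in rcosets (S b) Gam.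
    by apply/rcosetsP; exists 1; rewrite ?rcoset1.
  rewrite -(rcosets_side bs bc) in wc.
  exists x => //; apply: val_inj; rewrite val_cg_perm //.
  case/rcosetsP: wc wx => y _ -> /rcoset_eqP <-.
  by [].
case=> l Sl ->; have Gl := subsetP (sSG b) _ Sl; split.
  apply/existsP; exists b; rewrite val_cg_base_side // andbT.
  by apply/rcosetsP; exists 1; rewrite ?rcoset1.
apply/set0Pn; exists l; rewrite val_cg_perm // inE Sl.
exact: rcoset_refl.
Qed.

(** The index counts the cosets of [S (~~ b)] with a representative in [S b], without any inclusion
    between the two; these cosets are the neighbours of the base vertex. *)
Lemma cg_valency b v : v \in cg_side b -> valency cg_adj v = #|S b : S (~~ b)|.
Proof.
case/imsetP=> g Gg ->.
have ->: valency cg_adj (cg_perm g (cg_base b)) = valency cg_adj (cg_base b).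
  rewrite /valency -[RHS](card_imset _ (@perm_inj _ (cg_perm g))).
  apply: eq_card => w; rewrite -[w](permKV (cg_perm g)) inE cg_adj_perm //.
  by rewrite mem_imset ?inE //; apply: perm_inj.
rewrite /valency -(card_imset _ val_inj); apply: eq_card => A.
apply/imsetP/rcosetsP => [[w /[!inE] /cg_adj_baseP[l Sl ->] ->]|[l Sl ->]].
  by exists l; rewrite // val_cg_perm // (subsetP (sSG b)).
exists (cg_perm l (cg_base (~~ b))).
  by rewrite inE; apply/cg_adj_baseP; exists l.
by rewrite val_cg_perm // (subsetP (sSG b)).
Qed.

Let G := (cg_perm_morphism @* Gam)%G.

Lemma cg_graph_aut : G \subset graph_aut cg_adj.
Proof.
apply/subsetP=> _ /morphimP[g _ Gg ->]; rewrite inE.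
by apply/forallP=> A; apply/forallP=> B; rewrite cg_adj_perm.
Qed.

Lemma cg_orbit b g : g \in Gam ->
  orbit 'P G (cg_perm g (cg_base b)) = cg_side b.
Proof.
move=> Gg; apply/setP=> v; apply/orbitP/imsetP =>
  [[_ /morphimP[h _ Gh ->] <-]|].
  by exists (g * h); rewrite ?groupM // cg_permM // permM.
case=> h Gh ->; exists (cg_perm (g^-1 * h)).
  by apply: (mem_morphim cg_perm_morphism); rewrite groupM ?groupV.
by rewrite /= apermE -permM -cg_permM ?groupM ?groupV // mulKVg.
Qed.

Lemma cg_orbits :
  [set orbit 'P%act G v | v : cg_vertex] = [set cg_side true; cg_side false].
Proof.
have orb b : cg_side b \in [set orbit 'P%act G v | v : cg_vertex].
  by rewrite -(cg_orbit b (group1 Gam)) imset_f.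
apply/eqP; rewrite eqEsubset subUset !sub1set !orb !andbT.
apply/subsetP=> _ /imsetP[v _ ->]; have [b [g [Gg ->]]] := cg_vertexP v.
by rewrite cg_orbit // !inE; case: b; rewrite eqxx ?orbT.
Qed.

Lemma cg_sides_neq : cg_side true != cg_side false.
Proof.
apply/eqP=> eqs; have: cg_perm 1 (cg_base true) \in cg_side true.
  by apply: imset_f.
rewrite eqs => /imsetP[g Gg /(congr1 val) eqv].
have := val_cg_base_side true (group1 Gam); rewrite eqv => t1.
by have := rcosets_side t1 (val_cg_base_side false Gg).
Qed.

(* S b is 2-transitive on the neighbours of its vertex iff it is the union of at
   most two double cosets of the arc stabiliser. *)
Hypothesis dcS : forall b x y, x \in S b -> y \in S b ->
    x \notin S (~~ b) -> y \notin S (~~ b) ->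
  exists h k, [/\ h \in S b :&: S (~~ b), k \in S b :&: S (~~ b) & y = h * x *
    k].

(** With S' the other stabiliser, a 2-arc from S_b has the form S_b, S' l, S_b r l, where l is in
    S_b and r in S' but not in S_b. If r' = h r k as in [dcS], then l^-1 k l' carries the arc of (l,
    r) to that of (l', r'): k is absorbed by S' and h by S_b. *)
Lemma cg_base_arcs b w1 w2 u1 u2 :
    cg_adj (cg_base b) w1 -> cg_adj w1 w2 -> cg_base b != w2 ->
    cg_adj (cg_base b) u1 -> cg_adj u1 u2 -> cg_base b != u2 ->
  exists2 g, g \in S b & cg_perm g w1 = u1 /\ cg_perm g w2 = u2.
Proof.
have arcP w w' : cg_adj (cg_base b) w -> cg_adj w w' -> cg_base b != w' ->
    exists l r, [/\ l \in S b, r \in S (~~ b), r \notin S b,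
      w = cg_perm l (cg_base (~~ b)) & w' = cg_perm l (cg_perm r (cg_base b))].
  case/cg_adj_baseP=> l Sl ->; have Gl := subsetP (sSG b) _ Sl.
  rewrite -{1}[w'](permKV (cg_perm l)) cg_adj_perm //.
  case/cg_adj_baseP=> r Sr; rewrite negbK => def_w' neqw'.
  exists l, r; split=> //; last by rewrite -def_w' permKV.
  apply: contraNN neqw' => Sbr.
  by rewrite -[w'](permKV (cg_perm l)) def_w' !cg_base_perm.
move=> ew1 ew2 nw /arcP{}arcu /arcu{}arcu /arcu[l' [r' [Sl' Sr' S'r' -> ->]]].
have [l [r [Sl Sr S'r -> ->]]] := arcP w1 w2 ew1 ew2 nw.
have [||h [k [/setIP[Sh' Sh] /setIP[Sk' Sk] def_r']]] := dcS Sr Sr'.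
- by rewrite negbK.
- by rewrite negbK.
rewrite negbK in Sh Sk; have sG c x : x \in S c -> x \in Gam.
  exact: (subsetP (sSG c)).
exists (l^-1 * k * l'); first by rewrite !groupM ?groupV.
have [[Gl Gl'] Gk] := (sG _ _ Sl, sG _ _ Sl', sG _ _ Sk).
have [Gr Gh] := (sG _ _ Sr, sG _ _ Sh).
rewrite !cg_permM ?groupM ?groupV // (morphV cg_perm_morphism) //=.
rewrite !permM !permK (cg_base_perm Sk'); split=> //.
by rewrite def_r' !cg_permM ?groupM // !permM (cg_base_perm Sh).
Qed.

Lemma cg_locally_arc_transitive : locally_arc_transitive cg_adj G 2.
Proof.
pose i0 : 'I_3 := ord0.
pose i1 : 'I_3 := Ordinal (isT : 1 < 3)%N.
pose i2 : 'I_3 := Ordinal (isT : 2 < 3)%N.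
have arc3 (t : 3.-tuple cg_vertex) : is_arc cg_adj t ->
    [/\ cg_adj (tnth t i0) (tnth t i1), cg_adj (tnth t i1) (tnth t i2)
      & tnth t i0 != tnth t i2].
  move=> arct; split.
  - by case: (arct i0 i1) => + _; apply.
  - by case: (arct i1 i2) => + _; apply.
  by case: (arct i0 i2) => _; apply.
move=> a t u arct arcu ta ua; have [b [g [Gg def_a]]] := cg_vertexP a.
(* Both arcs are pulled back by [g] to start at a base vertex; the element found there is then
   conjugated by [g]. *)
pose pull (v : 3.-tuple cg_vertex) i := (cg_perm g)^-1 (tnth v i).
have h0 v : thead v = a -> pull v i0 = cg_base b.
  by rewrite def_a => va; rewrite /pull -[tnth v i0]/(thead v) va permK.
have pullP v : is_arc cg_adj v -> thead v = a ->
    [/\ cg_adj (cg_base b) (pull v i1), cg_adj (pull v i1) (pull v i2)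
      & cg_base b != pull v i2].
  move=> /arc3[e01 e12 n02] /h0 <-.
  by rewrite -(cg_adj_perm Gg) -(cg_adj_perm Gg (pull v i1)) !permKV (inj_eq
    perm_inj).
have [et1 et2 nt] := pullP t arct ta; have [eu1 eu2 nu] := pullP u arcu ua.
have [x Sx [x1 x2]] := cg_base_arcs et1 et2 nt eu1 eu2 nu.
have Gx := subsetP (sSG b) _ Sx.
exists (cg_perm (x ^ g)).
  apply/setIP; split; first by apply: (mem_morphim cg_perm_morphism);
    rewrite groupJ.
  apply/astab1P; rewrite /= apermE def_a -permM -cg_permM ?groupJ // -conjgC.
  by rewrite cg_permM // permM (cg_base_perm Sx).
have eqx v i : cg_perm (x ^ g) (tnth v i) = cg_perm g (cg_perm x (pull v i)).
  by rewrite conjgE !cg_permM ?groupM ?groupV // (morphV cg_perm_morphism) //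
    !permM.
apply: eq_from_tnth => i; rewrite tnth_map eqx.
case: i => [[|[|[|//]]] lti].
- rewrite (_ : Ordinal lti = i0); last exact: val_inj.
  by rewrite h0 // cg_base_perm // -(h0 u) // /pull permKV.
- rewrite (_ : Ordinal lti = i1); last exact: val_inj.
  by rewrite x1 /pull permKV.
rewrite (_ : Ordinal lti = i2); last exact: val_inj.
by rewrite x2 /pull permKV.
Qed.

End CosetGraph.

(** * The tetracode construction *)

Section WreathSubgroups.
Variables (k : nat) (gT : finGroupType).

Lemma wr_base_norm (T : {group gT}) :
  T <| [set: gT] -> [set: wr k gT] \subset 'N(wr_base k T).
Proof.
move=> /normal_norm/subsetP nT; apply/subsetP=> g _; rewrite inE.
apply/subsetP=> _ /imsetP[x /wr_baseP[x2 Tx] ->]; apply/wr_baseP.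
rewrite conjgE !wrE x2 mul1g mulVg; split=> // i.
by rewrite !wrE x2 perm1 -conjgE memJ_norm ?nT ?inE.
Qed.

(** This is M wr S_k. It serves to bound the coordinates of a group given by generators. *)
Definition wr_in (M : {set gT}) : {set wr k gT} :=
  [set g : wr k gT | [forall i, g.1 i \in M]].

Lemma wr_inP (M : {set gT}) (g : wr k gT) :
  reflect (forall i, g.1 i \in M) (g \in wr_in M).
Proof. by rewrite inE; apply: forallP. Qed.

Lemma wr_in_group_set (M : {group gT}) : group_set (wr_in M).
Proof.
apply/group_setP; split=> [|x y /wr_inP Mx /wr_inP My].
  by apply/wr_inP=> i; rewrite wrE.
by apply/wr_inP=> i; rewrite wrE groupM.
Qed.
Canonical wr_in_group M := Group (wr_in_group_set M).

Definition wr_diag (x : gT) : wr k gT := ([ffun=> x], 1).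

Lemma wr_diag1E x i : (wr_diag x).1 i = x.
Proof. by rewrite ffunE. Qed.

Fact wr_diagM : {in [set: gT] &, {morph wr_diag : x y / x * y}}.
Proof.
move=> x y _ _; apply: wrP => [i|]; last by rewrite wrE mulg1.
by rewrite wrE !wr_diag1E.
Qed.
Canonical wr_diag_morphism := Morphism wr_diagM.

Lemma wr_diag_inj : 0 < k -> injective wr_diag.
Proof.
move=> k_gt0 x y eqxy; pose i := Ordinal k_gt0.
by rewrite -(wr_diag1E x i) eqxy wr_diag1E.
Qed.

End WreathSubgroups.

Section Tetracode.
Variables (gT : finGroupType) (T X Y : {group gT}) (z c : gT).

Hypotheses (simT : simple T) (nabT : ~~ abelian T) (nT : T <| [set: gT]).
Hypothesis cT1 : 'C(T) = 1.
Hypothesis z2 : z ^+ 2 = 1.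
Hypothesis Tz : forall g, g \notin T -> g * z \in T.
Hypotheses (Tc : c \in T) (oc : #[c] = 3) (cz : c ^ z = c^-1).
Hypotheses (cXz : X \subset 'C[z]) (X'z : z \notin X).
Hypotheses (sYX : Y \subset X) (cYc : Y \subset 'C[c]) (ltYX : 1 < #|X : Y|).
Hypothesis dcX : forall x y, x \in X -> y \in X -> x \notin Y -> y \notin Y ->
  exists h k, [/\ h \in Y, k \in Y & y = h * x * k].

Let W := wr 4 gT.
Let N := (wr_base 4 T)%G.
Let dg := @wr_diag 4 gT.

Lemma ord4P (P : 'I_4 -> Prop) :
  P (inord 0) -> P (inord 1) -> P (inord 2) -> P (inord 3) -> forall i, P i.
Proof.
move=> P0 P1 P2 P3 i; rewrite -(inord_val i).
by case: i => [[|[|[|[|]]]]].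
Qed.

Definition shift4 : 'S_4 := perm (@ordS_inj 4).

Lemma val_shift4 j i : val ((shift4 ^+ j) i) = (i + j) %% 4.
Proof.
elim: j => [|j IHj]; first by rewrite perm1 addn0 modn_small.
by rewrite expgSr permM permE /= IHj -addn1 modnDml addn1 addnS.
Qed.

(* Conjugation by [tw] maps (f_0, f_1, f_2, f_3) to (f_3 ^ z, f_0, f_1, f_2). *)
Definition tw : W := ([ffun i => if i == ord_max then z else 1], shift4).

Lemma tw1E i : tw.1 i = if i == ord_max then z else 1.
Proof. by rewrite ffunE. Qed.

Lemma tw_mul2 j : (tw ^+ j).2 = shift4 ^+ j.
Proof. by elim: j => // j IHj; rewrite !expgS wrE IHj. Qed.

(** Going once round the 4-cycle, each coordinate passes the last place exactly once and picks up
    one factor [z]. *)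
Lemma tw4 : tw ^+ 4 = dg z.
Proof.
apply: wrP => [i|]; last first.
  rewrite tw_mul2; apply/permP=> i; apply: val_inj.
  by rewrite val_shift4 perm1 addnC modnDl modn_small.
rewrite wr_diag1E !expgS expg0 mulg1 !wrE !tw1E !permE -!val_eqE /=.
by case: i => [[|[|[|[|]]]] //= lti]; rewrite ?mulg1 ?mul1g.
Qed.

(** The shift has order 4, so such a power of [tw] is a power of [tw ^+ 4]. This controls the
    intersections with the base group. *)
Lemma tw_base j : (tw ^+ j).2 = 1 -> tw ^+ j = dg (z ^+ (j %/ 4)).
Proof.
rewrite tw_mul2 => /permP/(_ ord0)/(congr1 val);
  rewrite val_shift4 perm1 /= add0n.
move=> /eqP j4; rewrite -{1}(divnK j4) mulnC expgM tw4.
by rewrite -(morphX (wr_diag_morphism 4 gT)) ?inE.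
Qed.

Lemma tw_diag x : x \in X -> commute (dg x) tw.
Proof.
move/(subsetP cXz)/cent1P=> xz; apply: wrP => [i|]; last first.
  by rewrite !wrE mulg1 mul1g.
by rewrite !wrE !wr_diag1E perm1 tw1E; case: ifP; rewrite ?mulg1 ?mul1g.
Qed.

Lemma expc_mod3 m : c ^+ (m %% 3) = c ^+ m.
Proof. by rewrite -oc expg_mod_order. Qed.

Lemma expc_inj m m' : m < 3 -> m' < 3 -> c ^+ m = c ^+ m' -> m = m'.
Proof. by move=> lm lm' /eqP; rewrite eq_expg_mod_order oc !modn_small // =>
  /eqP. Qed.

(* The codewords of the tetracode, a negacyclic code over F_3 spanned by
   (2,1,1,0) and its negacyclic shift (0,2,1,1). *)
Definition tetra (a b : nat) : seq nat := [:: (2 * a)%N; (a + 2 * b)%N;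
  (a + b)%N; b].

Definition tw_code a b : W := ([ffun i : 'I_4 => c ^+ nth 0 (tetra a b) i], 1).

Lemma tw_code1E a b i : (tw_code a b).1 i = c ^+ nth 0 (tetra a b) i.
Proof. by rewrite ffunE. Qed.

Lemma tw_codeM a b a' b' :
  tw_code a b * tw_code a' b' = tw_code (a + a') (b + b').
Proof.
apply: wrP => [i|]; last by rewrite wrE mulg1.
rewrite wrE !tw_code1E perm1 -expgD; congr (c ^+ _).
by case: i => [[|[|[|[|]]]] //= _]; rewrite ?mulnDr // addnACA.
Qed.

Lemma tw_code_mod a b : tw_code (a %% 3) (b %% 3) = tw_code a b.
Proof.
apply: wrP => [i|] //; rewrite !tw_code1E -[LHS]expc_mod3 -[RHS]expc_mod3;
  congr (c ^+ _).
case: i => [[|[|[|[|]]]] //= _].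
- by rewrite modnMmr.
- by rewrite -modnDmr modnMmr modnDml modnDmr.
- by rewrite modnDm.
by rewrite modn_mod.
Qed.

Lemma tw_code00 : tw_code 0 0 = 1.
Proof.
apply: wrP => // i; rewrite tw_code1E wrE.
by case: i => [[|[|[|[|]]]] //= _].
Qed.

(** The twisted shift sends the exponents (2a, a+2b, a+b, b) to (-b, 2a, a+2b, a+b), which modulo 3
    is the word of the pair (b, a+b). *)
Lemma tw_codeJ a b : tw_code a b ^ tw = tw_code b (a + b).
Proof.
apply: (mulgI tw); rewrite -conjgC.
apply: wrP => [i|]; last by rewrite !wrE mulg1 mul1g.
rewrite !wrE perm1 !tw_code1E !tw1E !permE -!val_eqE /=.
case: i => [[|[|[|[|]]]] //= lti]; rewrite ?mulg1 ?mul1g.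
- by rewrite mulnDr addnCA -mulSn addnC (mulnC 3) -[RHS]expc_mod3 modnMDl
    expc_mod3.
- by rewrite addnCA addnn -mul2n.
- by [].
(* In the coordinate that wraps around, [z] inverts [c], and -b = 2b modulo 3. *)
rewrite conjgC conjXg cz expgVn; congr (_ * _).
apply: (mulIg (c ^+ b)); rewrite mulVg -expgD -mulSnr.
by rewrite expgM -oc expg_order expg1n.
Qed.

(** Numbering from 0, equality of entries 2 and 3 gives a = 0, and then entries 0 and 3 give b = 2a
    = 0 modulo 3. *)
Lemma tw_code_const a b x : tw_code a b = dg x -> tw_code a b = 1.
Proof.
move=> eq_x; have cst i j : (tw_code a b).1 i = (tw_code a b).1 j.
  by rewrite eq_x !wr_diag1E.
have /eqP b2a := cst (inord 0) (inord 3);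
  have /eqP a0 := cst (inord 2) (inord 3).
rewrite !tw_code1E !inordK //= !eq_expg_mod_order oc in b2a a0.
rewrite -[X in _ == X %[mod _]]add0n eqn_modDr mod0n in a0.
have b0: b %% 3 == 0 by rewrite -(eqP b2a) -modnMmr (eqP a0).
by rewrite -tw_code_mod (eqP a0) (eqP b0) tw_code00.
Qed.

Definition tw_codes : {set W} := [set tw_code a b | a : 'I_3, b : 'I_3].

Lemma tw_code_in a b : tw_code a b \in tw_codes.
Proof.
rewrite -tw_code_mod; apply/imset2P.
by exists (inord (a %% 3)) (inord (b %% 3)); rewrite ?inE ?inordK ?ltn_mod.
Qed.

Lemma tw_codes_group_set : group_set tw_codes.
Proof.
apply/group_setP; split; first by rewrite -tw_code00 tw_code_in.
by move=> _ _ /imset2P[a b _ _ ->] /imset2P[a' b' _ _ ->];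
  rewrite tw_codeM tw_code_in.
Qed.
Canonical tw_codes_group := Group tw_codes_group_set.

(** The last two entries, a+b and b, already determine a and b modulo 3. *)
Lemma card_tw_codes : #|tw_codes| = 9.
Proof.
have -> : tw_codes = [set tw_code p.1 p.2 | p : 'I_3 * 'I_3].
  apply/setP=> x; apply/imset2P/imsetP => [[a b _ _ ->]|[[a b] _ ->]].
    by exists (a, b).
  by exists a b.
rewrite card_imset ?card_prod ?card_ord // => -[a b] [a' b'] /= eqab.
have eqi i : c ^+ nth 0 (tetra a b) (i : 'I_4) = c ^+ nth 0 (tetra a' b') i.
  by rewrite -!tw_code1E eqab.
have := eqi (inord 3).
rewrite inordK //= => /(expc_inj (ltn_ord b) (ltn_ord b'))/val_inj eqb.
have := eqi (inord 2); rewrite inordK //= eqb // !expgD.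
by move/mulIg/(expc_inj (ltn_ord a) (ltn_ord a'))/val_inj->.
Qed.

(** The Fibonacci recurrence modulo 3. Its period is 8, so the orbit of (1, 0) runs through all
    nonzero pairs. *)
Definition tw_step (p : nat * nat) := (p.2, (p.1 + p.2) %% 3).

Lemma tw_codeJX a b j :
  tw_code a b ^ (tw ^+ j) =
    tw_code (iter j tw_step (a, b)).1 (iter j tw_step (a, b)).2.
Proof.
elim: j => [|j IHj]; first by rewrite conjg1.
rewrite expgSr conjgM IHj tw_codeJ /= -tw_code_mod;
  case: (iter _ _ _) => u v /=.
by rewrite -[RHS]tw_code_mod modn_mod.
Qed.

Lemma tw_codes_orbit e : e \in tw_codes -> e != 1 ->
  exists j, e = tw_code 1 0 ^ (tw ^+ j).
Proof.
case/imset2P=> a b _ _ -> nt.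
have: [exists j : 'I_8, iter j tw_step (1%N, 0) == (val a, val b)].
  have: (val a, val b) != (0, 0).
    by apply: contraNneq nt => -[-> ->]; rewrite tw_code00.
  case: a b {nt} => [[|[|[|//]]] lta] [[|[|[|//]]] ltb] //= _; apply/existsP.
  (* The witnesses are positions, counted from 0, in the orbit (1,0), (0,1), (1,1), (1,2), (2,0),
     (0,2), (2,2), (2,1). *)
  - by exists (inord 1); rewrite inordK.
  - by exists (inord 5); rewrite inordK.
  - by exists (inord 0); rewrite inordK.
  - by exists (inord 2); rewrite inordK.
  - by exists (inord 3); rewrite inordK.
  - by exists (inord 4); rewrite inordK.
  - by exists (inord 7); rewrite inordK.
  by exists (inord 6); rewrite inordK.
by case/existsP=> j /eqP jab; exists j; rewrite tw_codeJX jab.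
Qed.

(** * The two vertex stabilisers and the arc stabiliser *)

Definition tw_diag_group (A : {set gT}) := (dg @* A <*> <[tw]>)%G.

Let L := tw_diag_group X.
Let B := tw_diag_group Y.
Let R := (tw_codes <*> B)%G.
Let Gam := (N <*> <[tw]>)%G.

Lemma tw_dgX x m : dg (x ^+ m) = dg x ^+ m.
Proof. by rewrite -(morphX (wr_diag_morphism 4 gT)) ?inE. Qed.

Lemma tw_dgM x y : dg (x * y) = dg x * dg y.
Proof. by rewrite -(morphM (wr_diag_morphism 4 gT)) ?inE. Qed.

Lemma tw_diag_groupP (A : {group gT}) g : A \subset X ->
  reflect (exists x j, x \in A /\ g = dg x * tw ^+ j) (g \in tw_diag_group A).
Proof.
move=> sAX; rewrite /tw_diag_group /= cent_joinEr; last first.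
  rewrite cycle_subG; apply/centP=> _ /morphimP[x _ Ax ->].
  by apply/commute_sym/tw_diag/(subsetP sAX).
apply: (iffP mulsgP) =>
  [[_ _ /morphimP[x _ Ax ->] /cycleP[j ->] ->]|[x [j [Ax ->]]]].
  by exists x, j.
by exists (dg x) (tw ^+ j); rewrite ?mem_cycle ?mem_morphim ?inE.
Qed.

Lemma tw_codes_normB : B \subset 'N(tw_codes).
Proof.
rewrite join_subG cycle_subG; apply/andP; split.
  apply/cents_norm/centsP=> _ /morphimP[y _ Yy ->] _ /imset2P[a b _ _ ->].
  have /(subsetP cYc)/cent1P yc := Yy.
  apply: wrP => [i|]; last by rewrite !wrE.
  by rewrite !wrE !wr_diag1E !perm1 tw_code1E; apply/commuteX/commute_sym.
rewrite inE; apply/subsetP=> _ /imsetP[_ /imset2P[a b _ _ ->] ->].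
by rewrite tw_codeJ tw_code_in.
Qed.

Lemma tw_R_mul : R = tw_codes * B :> {set _}.
Proof. by rewrite /R /= norm_joinEr ?tw_codes_normB. Qed.

Lemma tw_sBL : B \subset L.
Proof. by rewrite genS // setSU // morphimS. Qed.

Lemma tw_sBR : B \subset R.
Proof. exact: joing_subr. Qed.

Lemma tw_sER : tw_codes \subset R.
Proof. exact: joing_subl. Qed.

(** An element of [L] with trivial permutation part is diagonal, and the only constant codeword is
    zero. *)
Lemma tw_code_L_triv e : e \in tw_codes -> e \in L -> e = 1.
Proof.
case/imset2P=> a b _ _ -> /(tw_diag_groupP _ (subxx X))[x [j [_ eq_e]]].
have twj: (tw ^+ j).2 = 1 by have := congr1 snd eq_e; rewrite wrE mul1g.
by rewrite (@tw_code_const a b (x * z ^+ (j %/ 4))) // eq_e (tw_base twj)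
  tw_dgM.
Qed.

(** Dedekind's law: as [R] = E B with [B] inside [L], the intersection is (L :&: E) B, and E meets
    [L] trivially. *)
Lemma tw_capLR : L :&: R = B.
Proof.
apply/eqP; rewrite eqEsubset subsetI tw_sBL tw_sBR !andbT;
  apply/subsetP=> g /setIP[].
rewrite tw_R_mul => Lg /mulsgP[e b Ee Bb def_g]; rewrite def_g.
have Le: e \in L by rewrite -(groupMr _ (subsetP tw_sBL _ Bb)) -def_g.
by rewrite (tw_code_L_triv Ee Le) mul1g.
Qed.

Lemma tw_in_Gam : tw \in Gam.
Proof. by rewrite (subsetP (joing_subr _ _)) ?cycle_id. Qed.

Lemma tw_sNGam : N \subset Gam.
Proof. exact: joing_subl. Qed.

Lemma tw_dg_in_Gam x : dg x \in Gam.
Proof.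
have baseG t : t \in T -> dg t \in Gam.
  move=> Tt; apply: (subsetP tw_sNGam); apply/wr_baseP; split=> // i.
  by rewrite wr_diag1E.
have dgz: dg z \in Gam by rewrite -tw4 groupX ?tw_in_Gam.
have [/baseG//|/Tz/baseG] := boolP (x \in T).
by rewrite tw_dgM groupMr.
Qed.

Lemma tw_sLGam : L \subset Gam.
Proof.
rewrite join_subG cycle_subG tw_in_Gam andbT.
by apply/subsetP=> _ /morphimP[x _ _ ->]; apply: tw_dg_in_Gam.
Qed.

Lemma tw_code_N e : e \in tw_codes -> e \in N.
Proof.
case/imset2P=> a b _ _ ->; apply/wr_baseP; split=> // i.
by rewrite tw_code1E groupX.
Qed.

Lemma tw_sRGam : R \subset Gam.
Proof.
rewrite join_subG (subset_trans tw_sBL tw_sLGam) andbT.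
by apply/subsetP=> e /tw_code_N; apply: (subsetP tw_sNGam).
Qed.

Lemma tw_z_expg_X m : z ^+ m \in X -> z ^+ m = 1.
Proof.
rewrite -(odd_double_half m) -mul2n expgD expgM z2 expg1n mulg1.
by case: odd; rewrite ?expg1 ?(negPf X'z).
Qed.

Lemma tw_code10_nt : tw_code 1 0 != 1.
Proof.
apply/eqP=> /(congr1 (fun g : W => g.1 (inord 2))).
rewrite tw_code1E wrE inordK //= expg1 => c1.
by move: oc; rewrite c1 order1.
Qed.

Lemma tw_neqLR : L :!=: R.
Proof.
apply: contraNneq tw_code10_nt => eqLR.
by rewrite (tw_code_L_triv (tw_code_in 1 0)) // eqLR (subsetP tw_sER)
  ?tw_code_in.
Qed.

(** [L] is the product of [B] and diag(X), so the index is that of diag(X) :&: B in diag(X). An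
    element of this intersection is diag(y z^m) with y in [Y]; then z^m lies in [X], so it is 1. *)
Lemma tw_index_LR : #|L : R| = #|X : Y|.
Proof.
have dg_inj : 'injm (wr_diag_morphism 4 gT).
  by apply/injmP=> x y _ _; apply: wr_diag_inj.
have defL : L = B * dg @* X :> {set _}.
  apply/eqP; rewrite eqEsubset mul_subG ?tw_sBL ?joing_subl // andbT.
  apply/subsetP=> g /(tw_diag_groupP _ (subxx X))[x [j [Xx ->]]].
  rewrite (commuteX j (tw_diag Xx)); apply: mem_mulg.
    by rewrite groupX // (subsetP (joing_subr _ _)) ?cycle_id.
  by rewrite mem_morphim ?inE.
have capXB : dg @* X :&: B = dg @* Y.
  apply/eqP; rewrite eqEsubset subsetI morphimS ?joing_subl // !andbT.
  apply/subsetP=> _ /setIP[/morphimP[x _ Xx ->] /(tw_diag_groupP _ sYX)[y [j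
    [Yy]]]].
  move=> /= eq_x; have twj: (tw ^+ j).2 = 1.
    by have := congr1 snd eq_x; rewrite wrE mul1g.
  move: eq_x; rewrite (tw_base twj) -tw_dgM => /wr_diag_inj def_x.
  have z1: z ^+ (j %/ 4) = 1.
    by apply: tw_z_expg_X; rewrite -(groupMl _ (subsetP sYX _ Yy)) -def_x.
  by rewrite def_x // z1 mulg1 mem_morphim ?inE.
by rewrite -indexgI tw_capLR defL indexMg -[LHS]indexgI capXB index_injm
  ?subsetT.
Qed.

Lemma tw_index_RL : #|R : L| = 9.
Proof.
rewrite -indexgI setIC tw_capLR tw_R_mul -(normC tw_codes_normB) indexMg
  -[LHS]indexgI.
have ->: tw_codes :&: B = 1.
  apply/trivgP/subsetP=> e /setIP[Ee Be]; rewrite inE.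
  by rewrite (tw_code_L_triv Ee) // (subsetP tw_sBL).
by rewrite indexg1 card_tw_codes.
Qed.

(** In [L] the powers of [tw] lie in [B], so the double coset condition for [X] and [Y] suffices. In
    [R] = E B, conjugation by [tw] fuses all nontrivial codewords, so everything outside [L] is one
    double coset of [B]. *)
Lemma tw_double_coset (S := fun b : bool => if b then L else R) b x y :
    x \in S b -> y \in S b -> x \notin S (~~ b) -> y \notin S (~~ b) ->
  exists h k, [/\ h \in S b :&: S (~~ b), k \in S b :&: S (~~ b) & y = h * x *
    k].
Proof.
have twB : tw \in B by rewrite (subsetP (joing_subr _ _)) ?cycle_id.
case: b => /=.
  rewrite tw_capLR => /(tw_diag_groupP _ (subxx X))[x0 [j [Xx ->]]].
  move=> /(tw_diag_groupP _ (subxx X))[y0 [m [Xy ->]]].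
  have notY u l : dg u * tw ^+ l \notin R -> u \notin Y.
    apply: contraNN => Yu; apply: (subsetP tw_sBR); apply/tw_diag_groupP => //.
    by exists u, l.
  move=> /notY Y'x /notY Y'y; have [h [k [Yh Yk ->]]] := dcX Xx Xy Y'x Y'y.
  have dgY u : u \in Y -> dg u \in B.
    by move=> Yu; rewrite (subsetP (joing_subl _ _)) ?mem_morphim ?inE.
  exists (dg h), (tw ^- j * dg k * tw ^+ m).
  by rewrite !groupM ?groupV ?groupX ?dgY // !tw_dgM !mulgA mulgK.
rewrite setIC tw_capLR tw_R_mul =>
  /mulsgP[e b Ee Bb ->] /mulsgP[e' b' Ee' Bb' ->].
have nt1 f b0 : b0 \in B -> f * b0 \notin L -> f != 1.
  move=> Bb0; apply: contraNneq => ->; rewrite mul1g.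
  exact: (subsetP tw_sBL).
move=> /(nt1 _ _ Bb)/(tw_codes_orbit Ee)[j def_e].
move=> /(nt1 _ _ Bb')/(tw_codes_orbit Ee')[m def_e'].
have [s Bs ->]: exists2 s, s \in B & e' = e ^ s.
  exists (tw ^- j * tw ^+ m); first by rewrite groupM ?groupV ?groupX.
  by rewrite def_e -conjgM mulKVg.
(* Here y = e^s b' = s^-1 (e b) (b^-1 s b'). *)
exists s^-1, (b^-1 * s * b'); split; rewrite ?groupM ?groupV //.
by rewrite conjgE !mulgA mulgK.
Qed.

(** The groups generated by the coordinates of [L] and [R], which take the role of M on the two
    sides. In the symmetric group they preserve {q, r} and {p, q, r}. *)
Let ML := (X <*> <[z]>)%G.
Let MR := ((<[c]> <*> <[z]>) <*> Y)%G.
Hypotheses (T'ML : ~~ (T \subset ML)) (T'MR : ~~ (T \subset MR)).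

Let S (b : bool) := if b then L else R.

Lemma tw_T_mul (M : {group gT}) : z \in M -> T * M = [set: gT].
Proof.
move=> Mz; apply/setP=> g; rewrite [RHS]inE -[g](mulgK z); apply/mulsgP.
have [Tg|/Tz Tgz] := boolP (g \in T).
  by exists g 1; rewrite ?group1 ?mulgK ?mulg1.
by exists (g * z) z^-1; rewrite ?groupV.
Qed.

Lemma tw_Gam_trans (i j : 'I_4) : exists2 g, g \in Gam & g.2 i = j.
Proof.
exists (tw ^+ (4 - i + j)); first by rewrite groupX ?tw_in_Gam.
rewrite tw_mul2; apply: val_inj; rewrite val_shift4 addnA subnKC;
  last exact: ltnW.
by rewrite modnDl modn_small.
Qed.

Lemma tw_Gam_norm : Gam \subset 'N(N).
Proof. exact: subset_trans (subsetT _) (wr_base_norm 4 nT). Qed.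

Lemma tw_Gam_mul (A : {group W}) : tw \in A -> Gam \subset N * A.
Proof.
move=> Atw; rewrite /Gam /= norm_joinEr ?mulgS ?cycle_subG //.
by rewrite (subsetP tw_Gam_norm) ?tw_in_Gam.
Qed.

Lemma tw_in_diag (A : {group gT}) : tw \in tw_diag_group A.
Proof. by rewrite (subsetP (joing_subr _ _)) ?cycle_id. Qed.

Lemma tw_dg_in_diag (A : {group gT}) x : x \in A -> dg x \in tw_diag_group A.
Proof. by move=> Ax; rewrite (subsetP (joing_subl _ _)) ?mem_morphim ?inE. Qed.

Lemma tw_dgz_in_diag (A : {group gT}) m : dg (z ^+ m) \in tw_diag_group A.
Proof. by rewrite tw_dgX groupX // -tw4 groupX ?tw_in_diag. Qed.

Lemma tw_dg_base t : t \in T -> dg t \in N.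
Proof. by move=> Tt; apply/wr_baseP; split=> // i; rewrite wr_diag1E. Qed.

Lemma tw_diag_in_wr (A M : {group gT}) :
  A \subset M -> z \in M -> tw_diag_group A \subset wr_in 4 M.
Proof.
move=> sAM Mz; rewrite join_subG cycle_subG; apply/andP; split.
  apply/subsetP=> _ /morphimP[x _ Ax ->]; apply/wr_inP=> i.
  by rewrite wr_diag1E (subsetP sAM).
by apply/wr_inP=> i; rewrite tw1E; case: ifP.
Qed.

Lemma tw_z_ML : z \in ML.
Proof. by rewrite (subsetP (joing_subr _ _)) ?cycle_id. Qed.

Lemma tw_z_MR : z \in MR.
Proof.
by rewrite (subsetP (joing_subl _ _)) // (subsetP (joing_subr _ _)) ?cycle_id.
Qed.

Lemma tw_L_in_ML g i : g \in L -> g.1 i \in ML.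
Proof. by move=> /(subsetP (tw_diag_in_wr (joing_subl _ _) tw_z_ML))/wr_inP.
  Qed.

Lemma tw_R_in_MR g i : g \in R -> g.1 i \in MR.
Proof.
move=> Rg; suff /subsetP/(_ g Rg)/wr_inP: R \subset wr_in 4 MR by apply.
rewrite join_subG (tw_diag_in_wr (joing_subr _ _) tw_z_MR) andbT.
apply/subsetP=> _ /imset2P[a b _ _ ->]; apply/wr_inP=> j;
  rewrite tw_code1E groupX //.
by rewrite (subsetP (joing_subl _ _)) // (subsetP (joing_subl _ _)) ?cycle_id.
Qed.

Lemma tw_L_proj (i : 'I_4) t : t \in T -> t \in ML ->
  exists2 g, g \in L :&: N & g.1 i = t.
Proof.
move=> Tt; rewrite /ML /= cent_joinEr ?cycle_subG //; last first.
  by rewrite -sub_cent1.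
case/mulsgP=> x _ Xx /cycleP[m ->] def_t; exists (dg t);
  last by rewrite wr_diag1E.
apply/setIP; split; last exact: tw_dg_base.
by rewrite def_t tw_dgM; apply: groupM;
  [apply: tw_dg_in_diag | apply: tw_dgz_in_diag].
Qed.

(** Write t = c^a z^m y. The factor z^m y is in T and lifts diagonally, and c^a lifts to a codeword
    with that entry at [i]. *)
Lemma tw_R_proj (i : 'I_4) t : t \in T -> t \in MR ->
  exists2 g, g \in R :&: N & g.1 i = t.
Proof.
move=> Tt; have nCz: <[z]> \subset 'N(<[c]>).
  by rewrite cycle_subG inE -cycleJ cz cycleV.
have cYK: Y \subset 'C(<[c]> <*> <[z]>).
  rewrite centsC join_subG !cycle_subG -!sub_cent1 cYc.
  exact: subset_trans sYX cXz.
rewrite /MR /= cent_joinEr //= (norm_joinEr nCz).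
case/mulsgP=> k y /mulsgP[_ _ /cycleP[a ->] /cycleP[m ->] ->] Yy def_t.
have Tzy: z ^+ m * y \in T.
  by rewrite -(groupMl _ (groupX a Tc)) mulgA -def_t.
(* Each coordinate of the code takes every value. In coordinate 0 the exponent is twice the first
   parameter, and 2a works because 4a = a modulo 3. *)
have [a' [b' cab]]: exists a' b', (tw_code a' b').1 i = c ^+ a.
  elim/ord4P: i.
  - exists (2 * a)%N, 0; rewrite tw_code1E inordK //= mulnA -[LHS]expc_mod3.
    by rewrite mulnC -modnMmr muln1 expc_mod3.
  - by exists a, 0; rewrite tw_code1E inordK //= addn0.
  - by exists a, 0; rewrite tw_code1E inordK //= addn0.
  by exists 0, a; rewrite tw_code1E inordK.
exists (tw_code a' b' * dg (z ^+ m * y)); last first.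
  by rewrite wrE cab wr_diag1E mulgA -def_t.
apply/setIP; split; apply: groupM;
  rewrite ?tw_dg_base ?tw_code_N ?tw_code_in //.
  by rewrite (subsetP tw_sER) ?tw_code_in.
apply: (subsetP tw_sBR); rewrite tw_dgM.
by apply: groupM; [apply: tw_dgz_in_diag | apply: tw_dg_in_diag].
Qed.

(** For x nontrivial in [X], one of x and x z lies in T, and x z is nontrivial since [z] is outside
    [X]. *)
Lemma tw_L_N_nt : L :&: N != 1.
Proof.
have /trivgPn[x Xx ntx]: X :!=: 1.
  apply: contraTneq ltYX => X1; rewrite X1 -leqNgt.
  by rewrite (leq_trans (leq_imset_card _ _)) ?cards1.
have dg1 t : dg t = 1 -> t = 1.
  by move/(congr1 (fun g : W => g.1 ord0)); rewrite wr_diag1E wrE.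
have [Tx|/Tz Txz] := boolP (x \in T); apply/trivgPn.
  exists (dg x); first by apply/setIP; rewrite tw_dg_base ?tw_dg_in_diag.
  by apply: contra_neq ntx => /dg1.
exists (dg (x * z)).
  apply/setIP; split; last exact: tw_dg_base.
  by rewrite tw_dgM; apply: groupM;
    [apply: tw_dg_in_diag | apply: (tw_dgz_in_diag X 1)].
apply: contraNneq X'z => /dg1/(canRL (mulKg x))->.
by rewrite mulg1 groupV.
Qed.

Lemma tw_R_N_code a b : tw_code a b \in R :&: N.
Proof. by rewrite in_setI tw_code_N ?(subsetP tw_sER) ?tw_code_in. Qed.

Lemma tw_R_N_nt : R :&: N != 1.
Proof. by apply/trivgPn; exists (tw_code 1 0);
  rewrite ?tw_R_N_code ?tw_code10_nt. Qed.

Lemma tw_L_N_diag g : g \in L :&: N -> forall i j, g.1 i = g.1 j.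
Proof.
case/setIP=> /(tw_diag_groupP _ (subxx X))[x [m [Xx ->]]] /wr_baseP[].
rewrite wrE mul1g => /tw_base-> _ i j.
by rewrite -tw_dgM !wr_diag1E.
Qed.

Lemma tw_code01_nt : tw_code 0 1 != 1.
Proof.
apply/eqP=> /(congr1 (fun g : W => g.1 (inord 3))).
rewrite tw_code1E wrE inordK //= expg1 => c1.
by move: oc; rewrite c1 order1.
Qed.

Theorem tetracode_graph :
  exists (V : finType) (e : rel V) (G : {group {perm V}}) (A B : {set V}),
    [/\ symmetric e, irreflexive e & G \subset graph_aut e] /\
    [/\ A != B,
        [set orbit 'P%act G v | v : V] = [set A; B],
        locally_arc_transitive e G 2,
        forall v, v \in A -> valency e v = #|X : Y| &
        forall v, v \in B -> valency e v = 9] /\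
    [/\ type_PA G A, type_PA G B, straight_diagonal_type G A &
        nondiagonal_type G B].
Proof.
have sS b : S b \subset Gam by case: b; [apply: tw_sLGam | apply: tw_sRGam].
have neqS : S true :!=: S false := tw_neqLR.
have stab b := @cg_base_stab _ Gam S b.
have k2 : (2 <= 4)%N by [].
have GamL := tw_Gam_mul (tw_in_diag X).
have GamR := tw_Gam_mul (subsetP tw_sBR _ (tw_in_diag Y)).
(* The nonzero word (0, 2, 1, 1) vanishes in coordinate 0; it is what makes the action on the cosets
   of [R] nondiagonal. *)
have code01 : (tw_code 0 1).1 ord0 = 1 by rewrite tw_code1E.
exists (cg_vertex Gam S), (@cg_adj _ Gam S), (cg_perm_morphism Gam S @* Gam)%G.
exists (cg_side Gam S true), (cg_side Gam S false); split.
  split; [exact: cg_adj_sym | exact: (cg_adj_irr neqS) | exact: cg_graph_aut].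
split; split.
- exact: (@cg_sides_neq _ Gam S neqS).
- exact: cg_orbits.
- exact: (cg_locally_arc_transitive sS neqS tw_double_coset).
- by move=> v /(cg_valency sS neqS)->; apply: tw_index_LR.
- by move=> v /(cg_valency sS neqS)->; apply: tw_index_RL.
- exact: (coset_type_PA k2 simT nabT nT cT1 (tw_T_mul tw_z_ML) T'ML tw_sNGam
    tw_Gam_norm tw_Gam_trans (stab true) tw_sLGam tw_L_in_ML GamL tw_L_N_nt).
- exact: (coset_type_PA k2 simT nabT nT cT1 (tw_T_mul tw_z_MR) T'MR tw_sNGam
    tw_Gam_norm tw_Gam_trans (stab false) tw_sRGam tw_R_in_MR GamR tw_R_N_nt).
- exact: (coset_straight k2 simT nabT nT cT1 (tw_T_mul tw_z_ML) T'ML tw_sNGam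
    tw_Gam_norm tw_Gam_trans (stab true) tw_sLGam tw_L_in_ML GamL tw_L_proj
    tw_L_N_nt tw_L_N_diag).
exact: (coset_nondiagonal k2 simT nabT nT cT1 (tw_T_mul tw_z_MR) T'MR tw_sNGam
    tw_Gam_norm tw_Gam_trans (stab false) tw_sRGam tw_R_in_MR GamR tw_R_proj
    tw_R_N_nt (tw_R_N_code 0 1) tw_code01_nt code01).
Qed.

End Tetracode.

(** * Alternating and symmetric groups *)

Lemma cent_Alt (D : finType) : 4 <= #|D| -> 'C('Alt_D) = 1.
Proof.
move=> D4; apply/trivgP/subsetP=> g /centP cg; rewrite inE; apply/eqP/permP=> x.
rewrite perm1; apply/eqP/negPn/negP=> gx.
(* If g moves x, take u and v distinct and outside {x, g x}. The 3-cycle on x, u, v moves x but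
   fixes g x, so it does not commute with g. *)
have /card_gt0P[u]: 0 < #|~: [set x; g x]|.
  by rewrite cardsCs setCK cards2 eq_sym gx subn_gt0 (leq_trans _ D4).
rewrite !inE negb_or => /andP[ux ugx].
have /card_gt0P[v]: 0 < #|~: (u |: [set x; g x])|.
  rewrite cardsCs setCK cardsU1 cards2 eq_sym gx subn_gt0 (leq_trans _ D4) //.
  by case: (_ \notin _).
rewrite !inE !negb_or => /and3P[vu vx vgx].
have /cg/permP/(_ x): tperm x u * tperm x v \in 'Alt_D.
  by rewrite Alt_even odd_permM !odd_tperm (eq_sym x u) ux (eq_sym x v) vx.
have gxu: tperm x u (g x) = g x by rewrite tpermD // eq_sym.
have gxv: tperm x v (g x) = g x by rewrite tpermD // eq_sym.
have uv: tperm x v u = u by rewrite tpermD // eq_sym.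
rewrite !permM tpermL gxu gxv uv => /perm_inj ux'.
by rewrite -ux' eqxx in ux.
Qed.

Section SymmetricGroupInstance.
Variables (D : finType) (p q r : D).
Hypotheses (Npq : p != q) (Npr : p != r) (Nqr : q != r) (D5 : 5 <= #|D|).

Let T := ('Alt_D)%G.
Let X := 'C([set q; r] | 'P)%G.
Let Y := 'C_X[p | 'P]%G.
Let z := tperm q r.
Let c := tperm p q * tperm p r.

Lemma cent_qrP (g : {perm D}) : reflect (g q = q /\ g r = r) (g \in X).
Proof.
apply: (iffP astabP) => [fix_g|[gq gr] x].
  by split; apply: fix_g; rewrite !inE eqxx ?orbT.
by rewrite !inE => /orP[] /eqP->.
Qed.

Lemma cent_pqrP (g : {perm D}) : reflect [/\ g p = p, g q = q & g r = r] (g \in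
  Y).
Proof.
apply: (iffP setIP) => [[/cent_qrP[gq gr] /astab1P gp]|[gp gq gr]] //.
by split; [apply/cent_qrP | apply/astab1P].
Qed.

Lemma cycle3_p : c p = q.
Proof. by rewrite permM tpermL tpermD // eq_sym. Qed.
Lemma cycle3_q : c q = r.
Proof. by rewrite permM tpermR tpermL. Qed.
Lemma cycle3_r : c r = p.
Proof. by rewrite permM (tpermD Npr Nqr) tpermR. Qed.

Lemma order_cycle3 : #[c] = 3.
Proof.
apply: nt_prime_order; first by [].
  apply/permP=> x; rewrite !expgS expg0 mulg1 perm1 permM [X in X = x]permM.
  have [->|xp] := eqVneq x p; first by rewrite cycle3_p cycle3_q cycle3_r.
  have [->|xq] := eqVneq x q; first by rewrite cycle3_q cycle3_r cycle3_p.
  have [->|xr] := eqVneq x r; first by rewrite cycle3_r cycle3_p cycle3_q.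
  have cx : c x = x by rewrite permM (tpermD (z :=
    x)) 1?eq_sym // tpermD // eq_sym.
  by rewrite !cx.
by apply/eqP=> /permP/(_ p); rewrite cycle3_p perm1 => /esym/eqP;
  rewrite (negPf Npq).
Qed.

Lemma cycle3_z : c ^ z = c^-1.
Proof.
rewrite conjMg !tpermJ invMg !tpermV tpermL tpermR.
by rewrite (tpermD (z := p)) // eq_sym.
Qed.

(** The orbit of [p] under [X] is the complement of {q, r}. *)
Lemma index_cent_pqr : #|X : Y| = #|D|.-2.
Proof.
rewrite /Y /= -card_orbit.
have ->: orbit 'P X p = ~: [set q; r].
  apply/setP=> x; rewrite !inE negb_or;
    apply/orbitP/andP=> [[g /cent_qrP[gq gr] <-]|[xq xr]].
    rewrite /= apermE.
    by split; [rewrite -[X in _ != X]gq | rewrite -[X in _ != X]gr];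
      rewrite (inj_eq perm_inj).
  exists (tperm p x); last by rewrite /= apermE tpermL.
  by apply/cent_qrP; rewrite !tpermD // eq_sym.
by rewrite cardsCs setCK cards2 Nqr subn2.
Qed.

(** The transposition [k] of [x p] and [y p] fixes p, q and r, and y k^-1 x^-1 fixes [p] because [k]
    takes [y p] back to [x p]. *)
Lemma double_coset_cent_qr x y : x \in X -> y \in X -> x \notin Y ->
  y \notin Y ->
  exists h k, [/\ h \in Y, k \in Y & y = h * x * k].
Proof.
have moves (g : {perm D}) : g \in X -> g \notin Y -> g p != p.
  by move=> /cent_qrP[gq gr]; apply: contraNneq => gp; apply/cent_pqrP.
move=> Xx Xy /(moves x Xx) xp /(moves y Xy) yp.
have [xq xr] := cent_qrP _ Xx; have [yq yr] := cent_qrP _ Xy.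
have img (g : {perm D}) : g q = q -> g r = r -> (g p != q) && (g p != r).
  move=> gq gr; rewrite -[X in _ != X]gq -[X in _ && (_ != X)]gr.
  by rewrite !(inj_eq perm_inj) Npq Npr.
have /andP[xpq xpr] := img x xq xr; have /andP[ypq ypr] := img y yq yr.
pose k := tperm (x p) (y p).
have kp : k p = p by rewrite tpermD.
have kq : k q = q by rewrite tpermD.
have kr : k r = r by rewrite tpermD.
exists (y * k^-1 * x^-1), k; split; last by rewrite -!mulgA mulKg mulVg mulg1.
  have ki : k (y p) = x p by rewrite tpermR.
  rewrite tpermV; apply/cent_pqrP; rewrite !permM ki yq yr kq kr.
  by rewrite permK; split=> //; [rewrite -{1}xq | rewrite -{1}xr];
    rewrite permK.
exact/cent_pqrP.
Qed.

Lemma Alt_transitive x y : x != y -> exists2 g, g \in T & g x = y.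
Proof.
move=> xy; have: 0 < #|~: [set x; y]|.
  by rewrite cardsCs setCK cards2 xy subn_gt0 (leq_trans _ D5).
case/card_gt0P=> u; rewrite !inE negb_or => /andP[ux uy].
exists (tperm x y * tperm x u).
  by rewrite Alt_even odd_permM !odd_tperm xy eq_sym ux.
by rewrite permM tpermL tpermD // eq_sym.
Qed.

(** The alternating group is transitive, so it preserves no proper nonempty subset. *)
Lemma Alt_not_sub_astabs (A : {set D}) (x : D) (M : {group {perm D}}) :
  M \subset 'N(A | 'P) -> x \in A -> #|A| < #|D| -> ~~ (T \subset M).
Proof.
move=> sMA Ax ltA; have: 0 < #|~: A| by rewrite cardsCs setCK subn_gt0.
case/card_gt0P=> y; rewrite inE => Ay.
have [|g Tg gx] := @Alt_transitive x y; first by apply: contraNneq Ay => <-.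
apply: contra Ay => /subsetP/(_ g Tg)/(subsetP sMA)/(astabs_act x).
by rewrite /= apermE gx Ax => ->.
Qed.

Lemma astabsI (A : {set D}) (g : {perm D}) :
  {in A, forall x, g x \in A} -> g \in 'N(A | 'P).
Proof. by move=> gA; rewrite !inE; apply/subsetP=> x Ax; rewrite inE /= gA. Qed.

Lemma tperm_astabs_qr : z \in 'N([set q; r] | 'P).
Proof.
by apply: astabsI => x; rewrite !inE => /orP[] /eqP->;
  rewrite ?tpermL ?tpermR eqxx ?orbT.
Qed.

Lemma Alt_not_sub_pair : ~~ (T \subset X <*> <[z]>).
Proof.
apply: (@Alt_not_sub_astabs [set q; r] q); rewrite ?inE ?eqxx //.
  by rewrite join_subG astab_sub cycle_subG tperm_astabs_qr.
by rewrite cards2 (leq_trans _ D5) //; case: (_ != _).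
Qed.

Lemma Alt_not_sub_triple : ~~ (T \subset (<[c]> <*> <[z]>) <*> Y).
Proof.
apply: (@Alt_not_sub_astabs [set p; q; r] p); rewrite ?inE ?eqxx //.
  rewrite !join_subG !cycle_subG -andbA; apply/and3P; split.
  - apply: astabsI => x; rewrite !inE -orbA => /or3P[] /eqP->;
      by rewrite ?cycle3_p ?cycle3_q ?cycle3_r eqxx ?orbT.
  - apply: astabsI => x; rewrite !inE -orbA => /or3P[] /eqP->;
      by rewrite ?tpermL ?tpermR ?[z p]tpermD 1?eq_sym ?eqxx ?orbT.
  apply/subsetP=> g /cent_pqrP[gp gq gr]; apply: astabsI => x.
  by rewrite !inE -orbA => /or3P[] /eqP->; rewrite ?gp ?gq ?gr eqxx ?orbT.
by apply: leq_trans D5; rewrite setUC cardsU1 cards2 Npq; case: (_ \notin _).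
Qed.

Lemma cent_qr_sub_cent1 : X \subset 'C[z].
Proof.
apply/subsetP=> g /cent_qrP[gq gr]; apply/cent1P/commute_sym/commgP/conjg_fixP.
by rewrite tpermJ gq gr.
Qed.

End SymmetricGroupInstance.

Theorem theorem3p11 :
  forall n : nat, (3 <= n)%N ->
  exists (V : finType) (e : rel V) (G : {group {perm V}}) (A B : {set V}),
    [/\ symmetric e, irreflexive e & G \subset graph_aut e] /\
    [/\ A != B,
        [set orbit 'P%act G v | v : V] = [set A; B],
        locally_arc_transitive e G 2,
        forall v, v \in A -> valency e v = n &
        forall v, v \in B -> valency e v = 9] /\
    [/\ type_PA G A, type_PA G B &
        (straight_diagonal_type G A /\ nondiagonal_type G B) \/
        (straight_diagonal_type G B /\ nondiagonal_type G A)].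
Proof.
move=> n n3; pose D := 'I_n.+2.
have lt2 : 2 < n.+2 by apply: leq_trans n3 _; rewrite ltnW.
have [p [q [r [Npq Npr Nqr]]]]: exists p q r : D, [/\ p != q, p != r & q != r].
  by exists ord0, (lift ord0 ord0), (Ordinal lt2).
(* With n + 2 points, n at least 3 is what makes the alternating group simple by [simple_Alt5]. *)
have D5 : 5 <= #|D| by rewrite card_ord.
have D4 : 4 <= #|D| by apply: ltnW.
have cT1 := cent_Alt D4.
have Tc : tperm p q * tperm p r \in 'Alt_D.
  by rewrite Alt_even odd_permM !odd_tperm Npq Npr.
have oc := order_cycle3 Npq Npr Nqr.
have ltYX : 1 < #|'C([set q; r] | 'P) : 'C_('C([set q; r] | 'P))[p | 'P]|.
  by rewrite index_cent_pqr // card_ord ltnW.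
have nabT : ~~ abelian ('Alt_D).
  apply: contraTN Tc; rewrite /abelian cT1 => /trivgP->; rewrite inE.
  by rewrite -order_eq1 oc.
have Tz (g : {perm D}) : g \notin 'Alt_D -> g * tperm q r \in 'Alt_D.
  by rewrite !Alt_even odd_permM odd_tperm Nqr negbK => ->.
have X'z : tperm q r \notin 'C([set q; r] | 'P).
  by apply/cent_qrP=> -[]; rewrite tpermL => /esym/eqP; rewrite (negPf Nqr).
have cYc : 'C_('C([set q; r] | 'P))[p | 'P] \subset 'C[tperm p q * tperm p r].
  apply/subsetP=> g /cent_pqrP[gp gq gr];
    apply/cent1P/commute_sym/commgP/conjg_fixP.
  by rewrite conjMg !tpermJ gp gq gr.
have z2 : tperm q r ^+ 2 = 1 by rewrite expgS tperm2.
have [V [e [G [A [B [autG [arcG [PA PB sA nB]]]]]]]] :=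
  tetracode_graph (simple_Alt5 D5) nabT (Alt_normal D) cT1 z2 Tz Tc oc
    (cycle3_z Npq Npr) (cent_qr_sub_cent1 q r) X'z (subsetIl _ _) cYc ltYX
    (double_coset_cent_qr Npq Npr) (Alt_not_sub_pair q r D5)
      (Alt_not_sub_triple Npq Npr Nqr D5).
exists V, e, G, A, B; rewrite index_cent_pqr // card_ord in arcG.
(* The side of valency n, formed by the cosets of diag(X) <tw>, is the straight diagonal one. *)
by split=> //; split=> //; split=> //; left.
Qed.
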